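(* Let $X$ be a metric continuum (a nonempty compact connected metric space), with the uniform structure induced by its metric. Then the following conditions are equivalent: (1) $X$ is weakly chained; (2) $X$ is locally uniformly joinable; (3) $X$ is uniformly joinable; (4) $X$ is pointed 1-movable.
   Context: Entourages: throughout, entourages of a uniform space are taken to be symmetric (the symmetric entourages form a base of the uniform structure); every entourage contains the diagonal. For a metric space $(X,d)$, the induced uniform structure has as a base the sets $E_\epsilon=\{(x,y)\in X\times X : d(x,y)\le\epsilon\}$, $\epsilon>0$. Chains: given an entourage $E$ of a uniform space $X$, an $E$-chain is a finite sequence $x_1,\dots,x_n$ of points of $X$ with $(x_i,x_{i+1})\in E$ for each $i<n$; it joins $x_1$ to $x_n$. The space $X$ is chain connected if for every entourage $E$ any two points of $X$ can be joined by an $E$-chain. Homotopy of chains: a subset $A\subset X$ is $E$-bounded if $A\times A\subset E$. The Rips complex $R(X,E)$ is the simplicial complex with vertex set $X$ whose simplices are the finite $E$-bounded subsets of $X$. An $E$-chain determines an edge path in $R(X,E)$ by joining successive terms by edges. Two $E$-chains with the same initial point and the same final point are $E$-homotopic if the corresponding paths in $R(X,E)$ are homotopic relative to endpoints; equivalently, one can be transformed into the other by finitely many moves, each adding or deleting a single point and yielding an $E$-chain, with endpoints kept fixed. The $E$-homotopy class of an $E$-chain $c$ is denoted $[c]_E$. Generalized paths: a generalized path from $x$ to $y$ in $X$ is a family $\alpha=\{[c_E]_E\}_E$, indexed by all entourages $E$ of $X$, where each $c_E$ is an $E$-chain from $x$ to $y$ and, whenever $F\subset E$ are entourages, $c_F$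 is $E$-homotopic to $c_E$. Write $\alpha_E=[c_E]_E$. A generalized path $\alpha$ from $x$ to $y$ is $E$-short if $(x,y)\in E$ and $\alpha_E=[x,y]_E$, the class of the two-term $E$-chain $x,y$. A uniform space $X$ is uniformly joinable if every pair of points of $X$ can be joined by a generalized path. It is locally uniformly joinable if for each entourage $E$ of $X$ there is an entourage $F$ of $X$ such that whenever $(x,y)\in F$, the points $x$ and $y$ can be joined by an $E$-short generalized path. A uniform space $X$ is weakly chained if it is chain connected and for every entourage $E$ of $X$ there exists an entourage $F\subset E$ such that for every $(x,y)\in F$ there exist arbitrarily fine chains $c$ joining $x$ to $y$ with $[c]_E=[x,y]_E$; that is, for every entourage $D\subset E$ there is a $D$-chain $c$ from $x$ to $y$ with $[c]_E=[x,y]_E$. Pointed 1-movability (standard notion of shape theory): embed the continuum $X$ in the Hilbert cube $Q$ and let $x_0\in X$. Then $X$ is pointed 1-movable if for every neighborhood $U$ of $X$ in $Q$ there is a neighborhood $V\subset U$ of $X$ such that for every neighborhood $W\subset U$ of $X$, every loop in $V$ based at $x_0$ is homotopic in $U$, relative to the basepoint, to a loop in $W$ based at $x_0$. For continua this property does not depend on the choice of embedding or of $x_0\in X$. *)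

(* Defs.v *)
From Stdlib Require Import Relation_Operators.
From HB Require Import structures.
From mathcomp Require Import all_boot all_order all_algebra.
From mathcomp Require Import all_classical all_reals all_analysis.
Import numFieldNormedType.Exports.

Set Implicit Arguments.
Unset Strict Implicit.
Unset Printing Implicit Defensive.

Local Open Scope classical_set_scope.
Local Open Scope ring_scope.

Section Chains.
Context {X : uniformType}.
Implicit Types (E F D : set (X * X)) (x y : X) (c : seq X).

Definition sym_entourage E :=
  entourage E /\ forall x y, E (x, y) -> E (y, x).

(* The chain x_1, ..., x_n is the sequence [:: x_1; ...; x_n]; it is nonempty
   because [ohead c] is defined. *)
Definition is_chain E x y c :=
  [/\ ohead c = Some x, last x c = y & sorted [rel a b | (a, b) \in E] c].

Definition chain_connected := forall E, sym_entourage E ->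
  forall x y, exists c, is_chain E x y c.

(* Edge-path homotopy in the Rips complex of E, as single-point moves between
   E-chains from x to y: both sequences being E-chains, an inserted point and
   its neighbours form an E-bounded set. Deletions come from the symmetric
   closure. *)
Definition chain_insertion E x y c c' :=
  [/\ is_chain E x y c, is_chain E x y c' &
      exists s t z, c = s ++ t /\ c' = s ++ z :: t].

Definition chain_homotopic E x y : seq X -> seq X -> Prop :=
  clos_refl_sym_trans (seq X) (chain_insertion E x y).

Definition chain_class E x y c : set (seq X) :=
  [set c' | chain_homotopic E x y c c'].

(* Only the values of [alpha] at symmetric entourages are meaningful. *)
Definition generalized_path x y (alpha : set (X * X) -> set (seq X)) :=
  exists c : set (X * X) -> seq X,
  [/\ forall E, sym_entourage E -> is_chain E x y (c E),
      forall E F, sym_entourage E -> sym_entourage F -> F `<=` E ->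
        chain_homotopic E x y (c F) (c E) &
      forall E, sym_entourage E -> alpha E = chain_class E x y (c E)].

Definition short_path E x y (alpha : set (X * X) -> set (seq X)) :=
  [/\ generalized_path x y alpha, E (x, y) &
      alpha E = chain_class E x y [:: x; y]].

End Chains.

Definition weakly_chained (X : uniformType) :=
  @chain_connected X /\
  forall E : set (X * X), sym_entourage E ->
  exists F : set (X * X), [/\ sym_entourage F, F `<=` E &
    forall x y, F (x, y) -> forall D, sym_entourage D -> D `<=` E ->
    exists2 c, is_chain D x y c &
      chain_class E x y c = chain_class E x y [:: x; y]].

Definition uniformly_joinable (X : uniformType) :=
  forall x y : X, exists alpha, generalized_path x y alpha.

Definition locally_uniformly_joinable (X : uniformType) :=
  forall E : set (X * X), sym_entourage E ->
  exists2 F : set (X * X), sym_entourage F &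
    forall x y, F (x, y) -> exists alpha, short_path E x y alpha.

Definition hilbert_cube (R : realType) :=
  {ptws nat -> set_type (`[0, 1]%classic : set R)}.

HB.instance Definition _ (R : realType) := Uniform.on (hilbert_cube R).

(* Injective, and the topology of X is the one induced by e. *)
Definition embedding {X Y : topologicalType} (e : X -> Y) :=
  injective e /\
  forall A : set X, open A <-> exists2 B, open B & A = e @^-1` B.

Section Loops.
Context {R : realType} {Y : topologicalType}.
Implicit Types (U : set Y) (p : Y) (g h : R -> Y).

(* Loops are parametrized by the unit interval; values outside it are
   irrelevant. *)
Definition loop_in U p g :=
  [/\ {within `[0, 1], continuous g}, g 0 = p, g 1 = p &
      forall t, `[0, 1]%classic t -> U (g t)].

Definition loop_homotopic_in U p g h :=
  exists H : R * R -> Y,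
  [/\ {within `[0, 1] `*` `[0, 1], continuous H},
      forall t, `[0, 1]%classic t -> H (0, t) = g t /\ H (1, t) = h t,
      forall s, `[0, 1]%classic s -> H (s, 0) = p /\ H (s, 1) = p &
      forall s t, `[0, 1]%classic s -> `[0, 1]%classic t -> U (H (s, t))].

End Loops.

Definition pointed_1_movable_in {R : realType} {X : topologicalType}
    (e : X -> hilbert_cube R) (x0 : X) :=
  forall U, set_nbhs (range e) U ->
  exists V, [/\ set_nbhs (range e) V, V `<=` U &
    forall W, set_nbhs (range e) W -> W `<=` U ->
    forall g : R -> hilbert_cube R, loop_in V (e x0) g ->
    exists2 h : R -> hilbert_cube R, loop_in W (e x0) h &
      loop_homotopic_in U (e x0) g h].

(* For a continuum the condition does not depend on e and x0, so that asking
   for some or for all of them is the same. *)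
Definition pointed_1_movable (R : realType) (X : topologicalType) :=
  exists (e : X -> hilbert_cube R) (x0 : X),
    embedding e /\ pointed_1_movable_in e x0.

(* Main.v *)
Require Import Defs.
From mathcomp Require Import all_boot all_order all_algebra.
From mathcomp Require Import all_classical all_reals all_analysis.
From mathcomp Require Import lra.
From Stdlib Require Import Relation_Operators.
Import Order.TTheory GRing.Theory Num.Theory.
Import numFieldNormedType.Exports.

Set Implicit Arguments.
Unset Strict Implicit.
Unset Printing Implicit Defensive.

Local Open Scope classical_set_scope.
Local Open Scope ring_scope.

(** Let [X] be a compact connected metric space. A chain is refinable, for
    fixed entourages D and E, if it is E-homotopic to a D-chain; up to
    E-homotopy the refinable chains form a subgroupoid of all E-chains, so that
    they can be cancelled from a composite. In these terms [X] is weakly chained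
    if for each E there is an F such that each F-edge is D-refinable for all D.

    Weakly chained implies locally joinable ([weakly_chained_locally_joinable])
    by choosing a cofinal sequence of such entourages and refining an edge again
    and again; local joinability gives joinability by composing short paths
    along a chain ([locally_joinable_joinable]).

    The converse [joinable_weakly_chained] is a theorem of Krasinkiewicz and
    Minc. Call two points short if the edge between them is refinable by all D.
    Rounding generalized paths from a base point to a finite net shows that [X]
    is a countable union of closed sets of pairwise short points. By the Baire
    category theorem every nonempty closed set [S] has a point near which [S]
    is a clique for shortness, so the set [deriv S] of the other points of [S]
    is a proper subset. Iterate this derivative, taking intersections at limit
    stages. Call a set tame if it is locally a clique. If [X] is not tame, then
    no stage has a nonempty clopen tame part ([tower_no_tame_part]): fine chains
    near a tame closed set can be projected to it, and the projections of
    consecutive points are short, so that refinability of the edge from a point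
    to its projection propagates along the chain ([reach_edge]); applied to the
    set of points that fine chains can reach near such a part, this contradicts
    the same property of an earlier stage. Therefore no stage is empty, and
    neither is the intersection of all stages, which is its own derivative. This
    is absurd; so [X] is tame, and by compactness nearby points are short.

    Pointed 1-movability is compared with weak chaining through the following
    Mittag-Leffler condition ([loops_refine]): for each E there is an F such
    that each F-loop at the base point is D-refinable for all D. Embed [X] in
    the Hilbert cube. A loop near [X] is sampled and rounded to a chain of [X],
    and a chain of [X] spans a polygon near [X]. The elementary moves between
    chains are straight-line deformations of polygons ([hom_deform]), which
    gives [refine_movable]; a homotopy of loops sampled on a fine grid gives a
    homotopy of chains, which yields the converse [movable_refine]. *)

(** * Chains and their homotopies *)

Section ChainAlgebra.
Context {X : uniformType}.
Implicit Types (E D : set (X * X)) (x y z : X) (c d : seq X).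

Lemma chain1 E x : is_chain E x x [:: x].
Proof. by split. Qed.

Lemma chain_cons E x x' y c :
  E (x, x') -> is_chain E x' y c -> is_chain E x y (x :: c).
Proof.
case: c => [|a s] Exx' [] //= [ax'] lst sr; split => //=.
by rewrite sr andbT; apply: mem_set; rewrite ax'.
Qed.

Lemma chain2 E x y : E (x, y) -> is_chain E x y [:: x; y].
Proof. by move=> Exy; apply: chain_cons Exy (chain1 _ _). Qed.

Lemma chain_ind E (P : X -> X -> seq X -> Prop) :
  (forall x, P x x [:: x]) ->
  (forall x x' y c, E (x, x') -> is_chain E x' y c -> P x' y c ->
     P x y (x :: c)) ->
  forall x y c, is_chain E x y c -> P x y c.
Proof.
move=> P1 Pc x y c; elim: c x => [|a [|b s] IH] x [] //= [->].
  by move=> <- _; exact: P1.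
move=> lst /andP[/set_mem ab sr].
have cb : is_chain E b y (b :: s) by [].
by apply: Pc ab cb _; apply: IH.
Qed.

Lemma chain_cat E x y y' z c d :
  is_chain E x y c -> is_chain E y' z d -> E (y, y') -> is_chain E x z (c ++ d).
Proof.
move=> cc cd; elim/chain_ind: cc => {x y c} [x|x x' y c xx' _ IH] /=.
  by move=> xy'; apply: chain_cons xy' cd.
by move=> yy'; apply: chain_cons xx' (IH yy').
Qed.

Lemma chain_sub E D x y c : D `<=` E -> is_chain D x y c -> is_chain E x y c.
Proof.
move=> DE; elim/chain_ind => {x y c} [x|x x' y c /DE xx' _ IH]; first exact: chain1.
exact: chain_cons xx' IH.
Qed.

Lemma chain_rev E x y c : (forall a b, E (a, b) -> E (b, a)) ->
  is_chain E x y c -> is_chain E y x (rev c).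
Proof.
move=> sE; elim/chain_ind => {x y c} [x|x x' y c xx' _ IH]; first exact: chain1.
rewrite rev_cons -cats1.
exact: chain_cat IH (chain1 _ _) (sE _ _ xx').
Qed.

Lemma chain_map (T : Type) (r : rel T) E (f : T -> X) a s' :
  path r a s' -> (forall p q, r p q -> E (f p, f q)) ->
  is_chain E (f a) (f (last a s')) (map f (a :: s')).
Proof.
move=> + rE; elim: s' a => [|b s' IH] a /=; first by move=> _; exact: chain1.
by move=> /andP[/rE ab /IH]; exact: chain_cons.
Qed.

Lemma hom_refl E x y c : chain_homotopic E x y c c.
Proof. exact: rst_refl. Qed.

Lemma hom_sym E x y c d : chain_homotopic E x y c d -> chain_homotopic E x y d c.
Proof. exact: rst_sym. Qed.

Lemma hom_trans E x y c d e : chain_homotopic E x y c d ->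
  chain_homotopic E x y d e -> chain_homotopic E x y c e.
Proof. exact: rst_trans. Qed.

Lemma hom_ins E x y s z t : is_chain E x y (s ++ t) ->
  is_chain E x y (s ++ z :: t) -> chain_homotopic E x y (s ++ t) (s ++ z :: t).
Proof. by move=> c1 c2; apply: rst_step; split => //; exists s, t, z. Qed.

Lemma hom_ind E x y (P : seq X -> seq X -> Prop) :
  (forall c, P c c) -> (forall c d, P c d -> P d c) ->
  (forall c d e, P c d -> P d e -> P c e) ->
  (forall s z t, is_chain E x y (s ++ t) -> is_chain E x y (s ++ z :: t) ->
     P (s ++ t) (s ++ z :: t)) ->
  forall c d, chain_homotopic E x y c d -> P c d.
Proof.
move=> Pr Ps Pt Pi c d; elim=> {c d}; [|exact: Pr|by move=> ? ? _ /Ps|].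
  by move=> c d [cc cd [s [t [z [cE dE]]]]]; subst c d; exact: Pi.
by move=> c d e _ Pcd _; exact: Pt.
Qed.

Lemma hom_chain E x y c d : chain_homotopic E x y c d ->
  is_chain E x y c -> is_chain E x y d.
Proof.
move=> H; have : is_chain E x y c <-> is_chain E x y d by
  elim/hom_ind: H => {c d}; [|move=> c d|move=> c d e|]; tauto.
by move=> [].
Qed.

Lemma hom_sub E D x y c d : D `<=` E ->
  chain_homotopic D x y c d -> chain_homotopic E x y c d.
Proof.
move=> DE; elim/hom_ind => {c d}.
- by move=> c; exact: hom_refl.
- by move=> c d; exact: hom_sym.
- by move=> c d e; exact: hom_trans.
- by move=> s z t c1 c2; apply: hom_ins; exact: chain_sub DE _.
Qed.

Lemma hom_catl E x y y' z c c' d : is_chain E x y d -> E (y, y') ->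
  chain_homotopic E y' z c c' -> chain_homotopic E x z (d ++ c) (d ++ c').
Proof.
move=> cd yy'; elim/hom_ind => {c c'}.
- by move=> c; exact: hom_refl.
- by move=> c c'; exact: hom_sym.
- by move=> c c' e; exact: hom_trans.
- move=> s w t c1 c2; rewrite !catA; apply: hom_ins; rewrite -catA.
    exact: chain_cat cd c1 yy'.
  exact: chain_cat cd c2 yy'.
Qed.

Lemma hom_catr E x y y' z c c' d : is_chain E y' z d -> E (y, y') ->
  chain_homotopic E x y c c' -> chain_homotopic E x z (c ++ d) (c' ++ d).
Proof.
move=> cd yy'; elim/hom_ind => {c c'}.
- by move=> c; exact: hom_refl.
- by move=> c c'; exact: hom_sym.
- by move=> c c' e; exact: hom_trans.
- move=> s w t c1 c2; rewrite -!catA cat_cons; apply: hom_ins.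
    by rewrite catA; exact: chain_cat c1 cd yy'.
  by rewrite -cat_cons catA; exact: chain_cat c2 cd yy'.
Qed.

Lemma hom_cat E x y y' z c c' d d' :
  is_chain E x y c -> is_chain E y' z d -> E (y, y') ->
  chain_homotopic E x y c c' -> chain_homotopic E y' z d d' ->
  chain_homotopic E x z (c ++ d) (c' ++ d').
Proof.
move=> cc cd yy' hc hd; apply: hom_trans (hom_catr cd yy' hc) _.
exact: hom_catl (hom_chain hc cc) yy' hd.
Qed.

Lemma hom_cons E x y y' c c' : E (x, y') ->
  chain_homotopic E y' y c c' -> chain_homotopic E x y (x :: c) (x :: c').
Proof. by move=> xy'; exact: (hom_catl (chain1 E x) xy'). Qed.

Lemma hom_rev E x y c d : (forall a b, E (a, b) -> E (b, a)) ->
  chain_homotopic E x y c d -> chain_homotopic E y x (rev c) (rev d).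
Proof.
move=> sE; elim/hom_ind => {c d}.
- by move=> c; exact: hom_refl.
- by move=> c d; exact: hom_sym.
- by move=> c d e; exact: hom_trans.
- move=> s z t /(chain_rev sE) c1 /(chain_rev sE) c2; move: c1 c2.
  rewrite !rev_cat rev_cons -cats1 -catA; exact: hom_ins.
Qed.

Lemma hom_triangle E x y z : E (x, y) -> E (y, z) -> E (x, z) ->
  chain_homotopic E x z [:: x; z] [:: x; y; z].
Proof.
move=> xy yz xz; apply: (@hom_ins _ _ _ [:: x] y [:: z]).
  exact: chain2.
exact: chain_cons xy (chain2 yz).
Qed.

(** Inserting the images under [g] one at a time, from the end of the ladder
    to its beginning, slides the rail [f] onto the rail [g]. *)
Lemma ladder (T : Type) (r : rel T) E (f g : T -> X) a s' :
  path r a s' ->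
  (forall p q, r p q ->
    [/\ E (f p, f q), E (g p, g q), E (g p, f q) & E (f q, g q)]) ->
  E (f a, g a) ->
  chain_homotopic E (f a) (g (last a s'))
    (map f (a :: s') ++ [:: g (last a s')]) (f a :: map g (a :: s')).
Proof.
move=> + rE; elim: s' a => [|b s' IH] a /=; first by move=> _ _; exact: hom_refl.
move=> /andP[/rE[fab gab gafb fgb] ps] fga.
have cg : is_chain E (g b) (g (last b s')) (map g (b :: s')).
  by apply: chain_map ps _ => p q /rE[].
apply: hom_trans (hom_cons fab (IH b ps fgb)) _ => /=.
have cf := chain_cons fgb cg.
apply: (@hom_trans _ _ _ _ (f a :: g a :: f b :: map g (b :: s'))).
  apply: (@hom_ins _ _ _ [:: f a] (g a) (f b :: map g (b :: s'))).
    exact: chain_cons fab cf.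
  exact: chain_cons fga (chain_cons gafb cf).
apply/hom_sym/(@hom_ins _ _ _ [:: f a; g a] (f b) (map g (b :: s'))).
  exact: chain_cons fga (chain_cons gab cg).
exact: chain_cons fga (chain_cons gafb cf).
Qed.

Lemma sym_refl E x : sym_entourage E -> E (x, x).
Proof. by move=> [entE _]; exact: entourage_refl. Qed.

Lemma sym_entourageI E D :
  sym_entourage E -> sym_entourage D -> sym_entourage (E `&` D).
Proof.
move=> [entE sE] [entD sD]; split; first exact: filterI.
by move=> x y [/sE ? /sD].
Qed.

Lemma hom_cancel E x y c : sym_entourage E -> is_chain E x y c ->
  chain_homotopic E x x (c ++ rev c) [:: x].
Proof.
move=> sE; have [_ sy] := sE.
elim/chain_ind => {x y c} [x|x x' y c xx' cc IH].
  apply/hom_sym/(@hom_ins _ _ _ [:: x] x [::]); first exact: chain1.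
  by apply: chain2; exact: sym_refl.
rewrite rev_cons -cats1 /= catA.
have cr : is_chain E x' x' (c ++ rev c).
  exact: chain_cat cc (chain_rev sy cc) (sym_refl y sE).
apply: (@hom_trans _ _ _ _ [:: x; x'; x]).
  exact: hom_cons xx' (hom_catr (chain1 _ _) (sy _ _ xx') IH).
apply: (@hom_trans _ _ _ _ [:: x; x]).
  apply/hom_sym/hom_triangle; [by []|exact: sy|exact: sym_refl].
apply/hom_sym/(@hom_ins _ _ _ [:: x] x [::]); first exact: chain1.
by apply: chain2; exact: sym_refl.
Qed.

(** Up to E-homotopy, [c] can be made as fine as [D]. *)
Definition refinable E D x y c :=
  exists2 c', is_chain D x y c' & chain_homotopic E x y c c'.

Section Refinable.
Variables E D : set (X * X).
Hypotheses (sE : sym_entourage E) (sD : sym_entourage D) (DE : D `<=` E).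

Lemma ref_chain x y c : is_chain D x y c -> refinable E D x y c.
Proof. by exists c => //; exact: hom_refl. Qed.

Lemma ref_hom x y c c' : chain_homotopic E x y c c' ->
  refinable E D x y c -> refinable E D x y c'.
Proof. by move=> h [d cd hd]; exists d => //; exact: hom_trans (hom_sym h) hd. Qed.

Lemma ref_is_chain x y c : refinable E D x y c -> is_chain E x y c.
Proof. by move=> [d cd /hom_sym h]; exact: hom_chain h (chain_sub DE cd). Qed.

Lemma ref_cat x y y' z c d : refinable E D x y c -> refinable E D y' z d ->
  D (y, y') -> refinable E D x z (c ++ d).
Proof.
move=> rc rd yy'; have [cc cd] := (ref_is_chain rc, ref_is_chain rd).
case: rc rd => c' cc' hc [d' cd' hd]; exists (c' ++ d').
  exact: chain_cat cc' cd' yy'.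
exact: hom_cat cc cd (DE yy') hc hd.
Qed.

Lemma ref_rev x y c : refinable E D x y c -> refinable E D y x (rev c).
Proof.
move=> [c' cc' h]; exists (rev c'); first by apply: chain_rev cc'; case: sD.
by apply: hom_rev h; case: sE.
Qed.

(** In the groupoid of chains up to E-homotopy the refinable chains are a
    subgroupoid, hence satisfy two-out-of-three. *)
Lemma ref_cancell x y y' z c d : refinable E D x y c -> is_chain E y' z d ->
  D (y, y') -> refinable E D x z (c ++ d) -> refinable E D y' z d.
Proof.
move=> rc cd yy' rcd; have [_ sy] := sE; have [_ syD] := sD.
have cc := ref_is_chain rc.
have crc : is_chain E y y (rev c ++ c).
  exact: chain_cat (chain_rev sy cc) cc (sym_refl _ sE).
have := ref_cat (ref_chain (chain1 D y'))
  (ref_cat (ref_rev rc) rcd (sym_refl _ sD)) (syD _ _ yy').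
apply: ref_hom; rewrite /= catA.
have hc : chain_homotopic E y y (rev c ++ c) [:: y].
  by rewrite -{2}(revK c); apply: hom_cancel (chain_rev sy cc).
apply: hom_trans (hom_cons (sy _ _ (DE yy')) (hom_catr cd (DE yy') hc)) _.
have y'y := sy _ _ (DE yy').
have cy : is_chain E y' z (y' :: y :: d).
  exact: chain_cons y'y (chain_cons (DE yy') cd).
have cy1 : is_chain E y' z (y' :: d) by exact: chain_cons (sym_refl _ sE) cd.
apply: (@hom_trans _ _ _ _ (y' :: d)).
  exact/hom_sym/(@hom_ins _ _ _ [:: y'] y d).
by apply/hom_sym/(@hom_ins _ _ _ [::] y' d).
Qed.

Lemma ref_cancelr x y y' z c d : refinable E D y' z d -> is_chain E x y c ->
  D (y, y') -> refinable E D x z (c ++ d) -> refinable E D x y c.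
Proof.
move=> rd cc yy' rcd; have [_ sy] := sE; have [_ syD] := sD.
rewrite -(revK c); apply: ref_rev.
apply: (ref_cancell (ref_rev rd) (chain_rev sy cc) (syD _ _ yy')).
by rewrite -rev_cat; exact: ref_rev.
Qed.

End Refinable.

End ChainAlgebra.

(** * Compactness and entourages of a metric space *)

(** A property of subsets that is inherited by subsets and by finite unions
    holds of a compact set as soon as it holds locally: otherwise the sets
    whose complement in [K] has the property form a filter on [K] without
    cluster point. *)
Lemma compact_induction (T : topologicalType) (K : set T) (P : set T -> Prop) :
  compact K -> P set0 -> (forall A B, A `<=` B -> P B -> P A) ->
  (forall A B, P A -> P B -> P (A `|` B)) ->
  (forall x, K x -> exists2 U, nbhs x U & P U) -> P K.
Proof.
move=> cK P0 Psub PU Ploc; apply: contrapT => nPK.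
pose F : set_system T := [set B | P (K `\` B)].
have FF : ProperFilter F.
  apply: Build_ProperFilter_ex.
    move=> B FB; apply: contrapT => B0; apply: nPK; apply: Psub FB.
    by move=> x Kx; split=> // Bx; apply: B0; exists x.
  split.
  - by rewrite /F/= setDT.
  - by move=> A B FA FB; rewrite /F/= setDIr; exact: PU.
  - by move=> A B AB; apply: Psub; exact: setDS.
have FK : F K by rewrite /F/= setDv.
have [x [Kx clx]] := cK F FF FK.
have [U Ux PUU] := Ploc x Kx.
have FU : F (~` U) by apply: Psub PUU => y [_ /contrapT].
by have [y []] := clx _ _ FU Ux.
Qed.

Lemma lebesgue_number (R : realType) (T : pseudoMetricType R) (K : set T)
    (P : T -> T -> Prop) : compact K ->
  (forall x, K x -> exists2 r : R, 0 < r &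
     forall y z, ball x r y -> ball x r z -> P y z) ->
  exists2 e : R, 0 < e & forall y z, K y -> ball y e z -> P y z.
Proof.
move=> cK Pl.
pose Q (A : set T) := exists2 e : R, 0 < e & forall y z, A y -> ball y e z -> P y z.
apply: (@compact_induction _ K Q) => //.
- by exists 1.
- by move=> A B AB [e e0 h]; exists e => // y z /AB; exact: h.
- move=> A B [e e0 h] [e' e'0 h']; exists (Num.min e e').
    by rewrite lt_min e0.
  move=> y z [Ay|By] yz; [apply: h Ay _|apply: h' By _];
    by apply: le_ball yz; rewrite ge_min lexx ?orbT.
- move=> x /Pl[r r0 h]; exists (ball x (r / 2)).
    by apply: nbhsx_ballx; rewrite divr_gt0.
  exists (r / 2); rewrite ?divr_gt0// => y z xy yz.
  apply: h; first by apply: le_ball xy; lra.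
  by rewrite (splitr r); exact: ball_triangle xy yz.
Qed.

Section MetricEntourages.
Context {R : realType} {X : metricType R}.
Implicit Types (x y z : X) (E D : set (X * X)).

Lemma nbhs_mdist x (e : R) : 0 < e -> nbhs x [set y | mdist x y < e].
Proof. by move=> e0; rewrite -ballEmdist; exact: nbhsx_ballx. Qed.

Lemma nbhs_mdistP x (U : set X) : nbhs x U ->
  exists2 e : R, 0 < e & forall y, mdist x y < e -> U y.
Proof.
move=> /nbhs_ballP[e /= e0 h]; exists e => // y xy; apply: h.
by rewrite ballEmdist.
Qed.

Definition dist_lt (e : R) : set (X * X) := [set xy | mdist xy.1 xy.2 < e].

Lemma sym_dist_lt e : 0 < e -> sym_entourage (dist_lt e).
Proof.
move=> e0; split; last by move=> x y; rewrite /dist_lt /= metric_sym.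
rewrite -entourage_ballE; exists e => //= -[x y] /=.
by rewrite ballEmdist.
Qed.

Lemma entourage_dist_lt E : entourage E -> exists2 e, 0 < e & dist_lt e `<=` E.
Proof.
rewrite -entourage_ballE => -[e /= e0 h]; exists e => // -[x y] xy; apply: h => /=.
by rewrite ballEmdist.
Qed.

Lemma closed_mdist (S : set X) x : closed S ->
  (forall e : R, 0 < e -> exists2 y, S y & mdist x y < e) -> S x.
Proof.
move=> clS h; apply: clS => U /nbhs_mdistP[e e0 eU].
by have [y Sy xy] := h e e0; exists y; split=> //; exact: eU.
Qed.

Lemma closed_avoid (S : set X) x : closed S -> ~ S x ->
  exists2 e : R, 0 < e & forall y, mdist x y < e -> ~ S y.
Proof.
move=> clS nSx; apply: nbhs_mdistP; apply: open_nbhs_nbhs; split => //.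
exact: closed_openC.
Qed.

(** The points that E-chains can reach from a given one form a clopen set. *)
Lemma connected_chain_connected : connected [set: X] -> @chain_connected X.
Proof.
move=> conX E sE x y; have [entE syE] := sE.
pose A := [set z | exists c, is_chain E x z c].
have [e e0 eE] := entourage_dist_lt entE.
suff AE : A = [set: X] by have : A y by rewrite AE.
apply: conX.
- by exists x; exists [:: x]; exact: chain1.
- exists A; last by rewrite setTI.
  rewrite openE => z [c cz]; apply: filterS (nbhs_mdist z e0) => w /= zw.
  by exists (c ++ [:: w]); apply: chain_cat cz (chain1 _ _) _; apply: eE.
- exists A; last by rewrite setTI.
  move=> z /(_ _ (nbhs_mdist z e0)) [w [[c cw] /= zw]].
  exists (c ++ [:: z]); apply: chain_cat cw (chain1 _ _) _; apply: eE.
  by rewrite /dist_lt /= metric_sym.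
Qed.

End MetricEntourages.

(** * Weakly chained spaces are joinable *)

Section Joinable.
Context {R : realType} {X : metricType R}.
Implicit Types (x y z : X) (E D F : set (X * X)) (c d : seq X).

Lemma chain_class_eq E x y c c' : chain_homotopic E x y c c' ->
  chain_class E x y c = chain_class E x y c'.
Proof.
move=> h; apply/seteqP; split=> d /= hd.
  exact: hom_trans (hom_sym h) hd.
exact: hom_trans h hd.
Qed.

Lemma chain_class_hom E x y c c' : chain_class E x y c = chain_class E x y c' ->
  chain_homotopic E x y c c'.
Proof.
move=> h; have : chain_class E x y c' c' by exact: hom_refl.
by rewrite -h.
Qed.

(** [F]-close points are joined, within the E-homotopy class of the edge
    between them, by arbitrarily fine chains. *)
Definition refines F E := forall x y, F (x, y) ->
  forall D, sym_entourage D -> D `<=` E -> refinable E D x y [:: x; y].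

Lemma weakly_chainedP : weakly_chained X <-> @chain_connected X /\
  forall E, sym_entourage E ->
  exists F, [/\ sym_entourage F, F `<=` E & refines F E].
Proof.
split=> -[cc h]; split=> // E sE; have [F [sF FE hF]] := h E sE; exists F;
  split=> // x y Fxy D sD DE.
  have [c cD cE] := hF x y Fxy D sD DE; exists c => //.
  exact/hom_sym/chain_class_hom.
have [c cD cE] := hF x y Fxy D sD DE; exists c => //.
exact/chain_class_eq/hom_sym.
Qed.

Lemma refines_chain F E D x y c :
  sym_entourage E -> sym_entourage D -> F `<=` E -> D `<=` E -> refines F E ->
  is_chain F x y c -> refinable E D x y c.
Proof.
move=> sE sD FE DE hF; elim/(@chain_ind X F) => {x y c} [x|x x' y c xx' cc IH].
  by apply: ref_chain; exact: chain1.
apply: ref_hom (ref_cat DE (hF _ _ xx' _ sD DE) IH (sym_refl _ sD)).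
have ccE := chain_sub FE cc.
apply/hom_sym/(@hom_ins X E x y [:: x] x' c).
  exact: chain_cons (FE _ xx') ccE.
exact: chain_cons (FE _ xx') (chain_cons (sym_refl _ sE) ccE).
Qed.

(** [G] is a decreasing cofinal sequence of entourages in which G(n+1)-edges are
    refinable up to G(n)-homotopy. Starting with the edge [x, y] and refining
    again and again gives G(n+1)-chains C(n), consecutive ones being
    G(n)-homotopic; at an entourage D the generalized path takes the value C(n)
    for some n with G(n) contained in D. *)
Lemma weakly_chained_locally_joinable :
  weakly_chained X -> locally_uniformly_joinable X.
Proof.
move=> /weakly_chainedP[_ wc] E sE.
pose nxt (n : nat) (G G' : set (X * X)) :=
  [/\ sym_entourage G', G' `<=` G, G' `<=` dist_lt n.+1%:R^-1 & refines G' G].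
have nxt_ex n G : sym_entourage G -> exists G', nxt n G G'.
  move=> /[dup] sG /wc[F [sF FG hF]].
  have n0 : (0 : R) < n.+1%:R^-1 by rewrite invr_gt0.
  exists (F `&` dist_lt n.+1%:R^-1); split.
  - exact: sym_entourageI sF (sym_dist_lt n0).
  - by move=> p [/FG].
  - by move=> p [].
  - by move=> x y [/hF].
have [G [G0 GS]] : exists G : nat -> set (X * X), G 0%N = E /\
    forall n, sym_entourage (G n) /\ nxt n (G n) (G n.+1).
  have [nx nxP] := choice (fun p : nat * {G | sym_entourage G} =>
    nxt_ex p.1 (sval p.2) (svalP p.2)).
  pose step n (q : {G | sym_entourage G}) : {G | sym_entourage G} :=
    exist _ (nx (n, q)) (let: And4 a _ _ _ := nxP (n, q) in a).
  pose g := fix g n := if n is m.+1 then step m (g m) else exist _ E sE.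
  exists (fun n => sval (g n)); split=> // n; split; first exact: svalP.
  exact: (nxP (n, g n)).
have sG n : sym_entourage (G n) by case: (GS n).
have Gmono m n : (m <= n)%N -> G n `<=` G m.
  elim: n => [|n IH]; first by rewrite leqn0 => /eqP ->.
  rewrite leq_eqVlt => /predU1P[->//|/IH h]; apply: subset_trans h.
  by case: (GS n) => _ [].
have Gcof D : sym_entourage D -> exists n, G n `<=` D.
  move=> [/entourage_dist_lt[e e0 eD] _].
  have [n ne] : exists n, (n.+1%:R^-1 < e :> R).
    exists (Num.truncn e^-1); rewrite invf_plt ?posrE//.
    by rewrite truncnS_gt.
  exists n.+1; case: (GS n) => _ [_ _ h _] p /h pn; apply: eD.
  exact: lt_trans pn ne.
exists (G 1%N) => // x y xy.
pose good n c := is_chain (G n.+1) x y c.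
have next n c : good n c -> exists2 c', good n.+1 c' & chain_homotopic (G n) x y c c'.
  move=> gc; case: (GS n) => _ [_ sub _ hr].
  have sub2 : G n.+2 `<=` G n by apply: Gmono; rewrite leqW.
  by have [c' ? ?] := refines_chain (sG n) (sG n.+2) sub sub2 hr gc; exists c'.
have [C [C0 CS]] : exists C : nat -> seq X, C 0%N = [:: x; y] /\
    forall n, good n (C n) /\ chain_homotopic (G n) x y (C n) (C n.+1).
  have g0 : good 0%N [:: x; y] by exact: chain2.
  have nx (p : {q : nat * seq X | good q.1 q.2}) : exists c',
      good (sval p).1.+1 c' /\ chain_homotopic (G (sval p).1) x y (sval p).2 c'.
    by case: p => -[n c] gc /=; have [c' ? ?] := next _ _ gc; exists c'.
  have [f fP] := choice nx.
  pose step (p : {q : nat * seq X | good q.1 q.2}) :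
      {q : nat * seq X | good q.1 q.2} :=
    exist _ ((sval p).1.+1, f p) (proj1 (fP p)).
  pose p0 : {q : nat * seq X | good q.1 q.2} := exist _ (0%N, [:: x; y]) g0.
  have itE n : (sval (iter n step p0)).1 = n by elim: n => //= n ->.
  exists (fun n => (sval (iter n step p0)).2); split=> // n.
  have := svalP (iter n step p0); rewrite itE => gn; split=> //=.
  by have [_] := fP (iter n step p0); rewrite itE.
have Chom m n : (m <= n)%N -> chain_homotopic (G m) x y (C m) (C n).
  elim: n => [|n IH]; first by rewrite leqn0 => /eqP ->; exact: hom_refl.
  rewrite leq_eqVlt ltnS => /predU1P[->|mn]; first exact: hom_refl.
  apply: hom_trans (IH mn) (hom_sub (Gmono _ _ mn) _).
  by case: (CS n).
have [k kP] := choice (fun D : {D | sym_entourage D} => Gcof _ (svalP D)).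
pose idx D := if pselect (sym_entourage D) is left s then k (exist _ D s) else 0%N.
have idxP D : sym_entourage D -> G (idx D) `<=` D.
  by move=> sD; rewrite /idx; case: pselect => // s; exact: (kP (exist _ D s)).
have GE n : G n `<=` E by rewrite -G0; exact: Gmono.
exists (fun D => chain_class D x y (C (idx D))); split.
- exists (fun D => C (idx D)); split=> //.
    move=> D sD; have [gD _] := CS (idx D); apply: chain_sub gD.
    exact: subset_trans (Gmono _ _ (leqnSn _)) (idxP _ sD).
  move=> D F sD sF FD; have [le|/ltnW le] := leqP (idx D) (idx F).
    by apply: hom_sub (idxP D sD) _; apply/hom_sym/Chom.
  apply: hom_sub (subset_trans (idxP F sF) FD) _; exact: Chom.
- exact: (GE 1%N).
- apply/chain_class_eq/hom_sym; rewrite -C0.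
  by apply: hom_sub (GE 0%N) _; exact: Chom.
Qed.

Lemma generalized_path_trans x y z alpha beta :
  generalized_path x y alpha -> generalized_path y z beta ->
  exists gamma, generalized_path x z gamma.
Proof.
move=> [c [cc ch _]] [d [dc dh _]].
exists (fun E => chain_class E x z (c E ++ d E)); exists (fun E => c E ++ d E).
split=> // [E sE|E F sE sF FE].
  exact: chain_cat (cc E sE) (dc E sE) (sym_refl _ sE).
apply: (@hom_cat X E x y y z) (sym_refl _ sE) (ch E F sE sF FE) (dh E F sE sF FE).
  exact: chain_sub FE (cc F sF).
exact: chain_sub FE (dc F sF).
Qed.

Lemma locally_joinable_joinable : connected [set: X] ->
  locally_uniformly_joinable X -> uniformly_joinable X.
Proof.
move=> /connected_chain_connected conX lj x y.
have sT : sym_entourage [set: X * X] by split=> //; exact: filterT.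
have [F sF hF] := lj _ sT.
have [c] := conX F sF x y.
have gF u v : F (u, v) -> exists alpha, generalized_path u v alpha.
  by move=> /hF[alpha []]; exists alpha.
elim/(@chain_ind X F) => {x y c} [x|x x' y c /gF[alpha ga] _ [beta gb]].
  by apply: gF; exact: sym_refl.
exact: generalized_path_trans ga gb.
Qed.

End Joinable.

(** * Joinable continua are weakly chained *)

Section KrasinkiewiczMinc.
Context {R : realType} {X : metricType R}.
Hypothesis cX : compact [set: X].
Variables (E : set (X * X)) (eta : R).
Hypotheses (sE : sym_entourage E) (eta0 : 0 < eta)
  (etaE : dist_lt (8 * eta) `<=` E).
Implicit Types (x y z : X) (D : set (X * X)) (M S : set X) (r nu : R).

Definition edge D x y := refinable E D x y [:: x; y].

Section Edge.
Variable D : set (X * X).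
Hypotheses (sD : sym_entourage D) (DE : D `<=` E).

Lemma edgeW x y : D (x, y) -> edge D x y.
Proof. by move=> xy; apply: ref_chain; exact: chain2. Qed.

Lemma edge_sub x y : edge D x y -> E (x, y).
Proof. by move=> /(ref_is_chain DE)[_ _ /= /andP[/set_mem]]. Qed.

Lemma edge_sym x y : edge D x y -> edge D y x.
Proof. exact: (ref_rev sE sD). Qed.

Lemma edge_trans x y z : edge D x y -> edge D y z -> mdist x z < 8 * eta ->
  edge D x z.
Proof.
move=> xy yz /(@etaE (_, _)) xz.
apply: ref_hom (ref_cat DE xy yz (sym_refl _ sD)).
have [Exy Eyz] := (edge_sub xy, edge_sub yz).
have cyz := chain2 Eyz.
apply/hom_sym/(hom_trans (hom_triangle Exy Eyz xz)).
apply: (@hom_ins _ _ _ _ [:: x] y [:: y; z]); first exact: chain_cons Exy cyz.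
by apply: chain_cons Exy (chain_cons _ cyz); exact: sym_refl.
Qed.

End Edge.

(** A [short] pair is joined by arbitrarily fine chains that do not leave the
    E-homotopy class of the edge. *)
Definition short x y :=
  mdist x y <= eta /\ forall D, sym_entourage D -> D `<=` E -> edge D x y.

Lemma short_sym x y : short x y -> short y x.
Proof.
move=> [xy h]; split=> [|D sD DE]; first by rewrite metric_sym.
by apply: edge_sym => //; exact: h.
Qed.

Lemma short_trans x y z : short x y -> short y z -> mdist x z <= eta -> short x z.
Proof.
move=> [xy hxy] [yz hyz] xz; split=> // D sD DE.
have e0 := eta0; apply: (edge_trans sD DE (hxy D sD DE) (hyz D sD DE)); lra.
Qed.

(** Shortness is a closed relation because a limit pair is joined to an
    approximating pair by two D-small steps. *)
Lemma short_closed x y : (forall r, 0 < r ->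
    exists x' y', [/\ mdist x x' < r, mdist y y' < r & short x' y']) ->
  short x y.
Proof.
move=> h; have e0 := eta0; split=> [|D sD DE].
  apply/ler_addgt0Pr => r r0.
  have [|x' [y' [xx' yy' [xy _]]]] := h (r / 2); first by rewrite divr_gt0.
  have := metric_triangle x x' y; have := metric_triangle x' y' y.
  rewrite (metric_sym y' y); lra.
have [r r0 rD] := entourage_dist_lt sD.1.
have [|x' [y' [xx' yy' [xy xyD]]]] := h (Num.min r eta); first by rewrite lt_min r0.
rewrite !lt_min in xx' yy'; have /andP[xx'r xx'e] := xx'.
have /andP[yy'r yy'e] := yy'.
have t1 := metric_triangle x x' y'; have t2 := metric_triangle x y' y.
rewrite (metric_sym y' y) in t2.
apply: (@edge_trans D sD DE x y' y); last lra.
  apply: (@edge_trans D sD DE x x' y'); [exact/edgeW/rD|exact: xyD|lra].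
by apply: (edge_sym sD); apply: edgeW; exact: rD.
Qed.

(** ** Countably many cliques *)

Lemma finite_net (e : R) : 0 < e ->
  exists s : seq X, forall x, exists2 i, (i < size s)%N & mdist x (nth x s i) < e.
Proof.
move=> e0.
have [s hs] : exists s : seq X, forall x, [set: X] x -> exists2 a, a \in s & mdist x a < e.
  apply: (@compact_induction _ _ (fun A : set X => exists s : seq X,
    forall x, A x -> exists2 a, a \in s & mdist x a < e) cX).
  - by exists [::].
  - by move=> A B AB [s hs]; exists s => x /AB; exact: hs.
  - move=> A B [s hs] [t ht]; exists (s ++ t) => x [/hs|/ht] [a ain xa];
      by exists a => //; rewrite mem_cat ain ?orbT.
  - move=> x _; exists [set y | mdist x y < e]; first exact: nbhs_mdist.
    by exists [:: x] => y /= xy; exists x; rewrite ?inE// metric_sym.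
exists s => x; have [a /(nthP x)[i si <-] xa] := hs x I.
by exists i.
Qed.

(** Rounding a generalized path starting at [p] to a finite net leaves
    countably many E-homotopy types of its E-component, and two end points
    reached with the same type are short. *)
Lemma clique_cover : [set: X] !=set0 -> uniformly_joinable X ->
  exists B : nat -> set X, [/\ forall n, closed (B n), forall x, exists n, B n x &
    forall n x y, B n x -> B n y -> short x y].
Proof.
move=> [p _] uj; have e0 := eta0.
have [s hs] : exists s : seq X, forall x, exists2 i, (i < size s)%N &
    mdist x (nth x s i) < eta / 4 by apply: finite_net; rewrite divr_gt0.
pose g i := nth p s i.
have /choice[idx idxP] x : exists i, mdist x (g i) < eta / 4.
  by have [i si xi] := hs x; exists i; rewrite /g (set_nth_default x).
pose B n : set X := [set y | exists l : seq nat, let v := p :: map g l in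
  [/\ unpickle n = Some l, is_chain E p (last p v) v, mdist (last p v) y < eta / 4 &
   forall D, sym_entourage D -> D `<=` E -> refinable E D p y (v ++ [:: y])]].
have BC n x y : B n x -> B n y -> short x y.
  move=> [l [nl cv vx hx]] [l' [+ _ + hy]].
  rewrite nl => -[ll']; subst l' => vy.
  set v := p :: map g l in cv hx hy; set b := last p v in cv vx vy.
  have xy := metric_triangle x b y; rewrite (metric_sym x b) in xy.
  split=> [|D sD DE]; first lra.
  apply: ref_hom (ref_cat DE (ref_rev sE sD (hx D sD DE)) (hy D sD DE) (sym_refl _ sD)).
  rewrite rev_cat catA /= -(cat1s x) -!catA.
  have Ebx : E (b, x) by apply: etaE; rewrite /dist_lt/=; lra.
  have Eby : E (b, y) by apply: etaE; rewrite /dist_lt/=; lra.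
  have Exy : E (x, y) by apply: etaE; rewrite /dist_lt/=; lra.
  have Exb := sE.2 _ _ Ebx.
  have h1 : chain_homotopic E b b (rev v ++ v) [:: b].
    by rewrite -{2}(revK v); apply: hom_cancel => //; apply: chain_rev sE.2 cv.
  apply/hom_sym/(hom_trans (hom_triangle Exb Eby Exy))/hom_sym.
  apply: (@hom_cons _ _ _ _ _ _ [:: b; y] Exb); rewrite catA.
  exact: (hom_catr (chain1 E y) Eby h1).
exists (fun n => closure (B n)); split.
- by move=> n; exact: closed_closure.
- move=> y; suff : exists n, B n y by move=> [n yn]; exists n; exact: subset_closure.
  have [alpha [c [cc ch _]]] := uj p y.
  have e40 : 0 < eta / 4 by rewrite divr_gt0.
  pose E1 := E `&` dist_lt (eta / 4).
  have sE1 : sym_entourage E1 := sym_entourageI sE (sym_dist_lt e40).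
  have E1E : E1 `<=` E by move=> q [].
  pose f x := g (idx x).
  have cE1 := cc _ sE1.
  have fE a b : mdist a b < eta / 4 ->
      [/\ E (a, b), E (f a, f b), E (f a, b) & E (b, f b)].
    move=> ab; have := idxP a; have := idxP b; rewrite -/(f a) -/(f b) => bfb afa.
    have t1 := metric_triangle (f a) a b; have t2 := metric_triangle (f a) b (f b).
    rewrite (metric_sym (f a) a) in t1.
    by split; apply: etaE; rewrite /dist_lt/=; lra.
  have fE1 a : E (a, f a) by have [] := fE a a _; rewrite ?mdistxx.
  have cu := chain_sub E1E cE1.
  case Eu: (c E1) cE1 cu => [|q t]; first by case.
  move=> [[qp] lst sr]; move: qp lst sr Eu => -> lst sr Eu cu.
  have {}lst : last p t = y by [].
  have lad := @ladder X X _ E id f p t sr _ (fE1 p).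
  have {}lad : chain_homotopic E p (f y) ((p :: t) ++ [:: f y]) (p :: map f (p :: t)).
    rewrite /= in lst; rewrite -lst -{1}(map_id (p :: t)); apply: lad => a b /set_mem[_ ab].
    exact: fE.
  exists (pickle (map idx (p :: t))); exists (map idx (p :: t)).
  have mE : map g (map idx (p :: t)) = map f (p :: t) by rewrite -map_comp.
  rewrite pickleK; cbn zeta; rewrite mE.
  have lE : last p (p :: map f (p :: t)) = f y by rewrite /= last_map lst.
  rewrite lE; split; [by []| | | ].
  + apply: (hom_chain lad); exact: chain_cat cu (chain1 _ _) (fE1 y).
  + by rewrite metric_sym; exact: idxP.
  + move=> D sD DE.
    have sD1 := sym_entourageI sD sE1.
    have r1 : refinable E D p y (p :: t).
      exists (c (D `&` E1)).
        by apply: chain_sub (cc _ sD1) => q' [].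
      apply/hom_sym/(hom_sub E1E); rewrite -Eu; apply: ch => //.
    apply: (ref_hom _ r1).
    have Efy : E (f y, y) := sE.2 _ _ (fE1 y).
    have Eyy := sym_refl y sE.
    apply: (hom_trans _ (hom_catr (chain1 E y) Efy lad)).
    have cuy : is_chain E p y ((p :: t) ++ [:: y]) := chain_cat cu (chain1 _ _) Eyy.
    have h1 : chain_homotopic E p y (p :: t) ((p :: t) ++ [:: y]).
      by have := @hom_ins X E p y (p :: t) y [::]; rewrite cats0; exact.
    apply: hom_trans h1 _; rewrite -catA; apply: hom_ins => //.
    exact: chain_cat cu (chain2 Efy) (fE1 y).
- move=> n x y clx cly; apply: short_closed => r r0.
  have [x' [Bx' /= xx']] := clx _ (nbhs_mdist x r0).
  have [y' [By' /= yy']] := cly _ (nbhs_mdist y r0).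
  by exists x', y'; split => //; exact: BC Bx' By'.
Qed.


(** ** Thinning out *)

Definition isolated S x := exists2 r, 0 < r &
  forall y, S y -> mdist x y < r -> short x y.

(** The analogue, for cliques of the shortness relation instead of single
    points, of the Cantor-Bendixson derivative. *)
Definition deriv S := [set x | S x /\ ~ isolated S x].

Definition tame M := forall x, M x -> isolated M x.

(** For closed [S], to be relatively clopen at a uniform distance. *)
Definition clopen_in M S := M `<=` S /\
  exists2 r, 0 < r & forall x y, M x -> S y -> mdist x y < r -> M y.

Definition no_tame_part S :=
  forall M, clopen_in M S -> M !=set0 -> tame M -> False.

Lemma deriv_sub S : deriv S `<=` S. Proof. by move=> x []. Qed.

Lemma isolated_sub S S' x : S `<=` S' -> isolated S' x -> isolated S x.
Proof. by move=> SS' [r r0 h]; exists r => // y /SS'; exact: h. Qed.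

Lemma deriv_mono S S' : S `<=` S' -> deriv S `<=` deriv S'.
Proof.
move=> SS' x [Sx nx]; split; first exact: SS'.
by apply: contra_not nx; exact: isolated_sub.
Qed.

Lemma deriv_closed S : closed S -> closed (deriv S).
Proof.
move=> clS x clx; have e0 := eta0.
have Sx : S x by apply: clS; apply: closureS clx; exact: deriv_sub.
split=> // -[r r0 h].
pose e := Num.min (r / 2) (eta / 2).
have e1 : 0 < e by rewrite lt_min !divr_gt0.
have [y [[Sy nisoy] /= ]] := clx _ (nbhs_mdist x e1).
rewrite lt_min => /andP[xy1 xy2]; apply: nisoy.
exists e => // z Sz; rewrite lt_min => /andP[yz1 yz2].
have t1 := metric_triangle x y z.
apply: (short_trans (short_sym (h y Sy _)) (h z Sz _)); lra.
Qed.

(** Baire category: a derivative-perfect closed set cannot be covered by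
    countably many closed cliques. *)
Lemma deriv_not_perfect S (B : nat -> set X) :
  (forall n, closed (B n)) -> (forall x, exists n, B n x) ->
  (forall n x y, B n x -> B n y -> short x y) ->
  closed S -> S !=set0 -> ~ (S `<=` deriv S).
Proof.
move=> clB covB cliqueB clS [x0 Sx0] perfS.
have step (n : nat) (q : {q : X * R | S q.1 /\ 0 < q.2}) :
    exists q' : {q : X * R | S q.1 /\ 0 < q.2},
      [/\ mdist (sval q).1 (sval q').1 < (sval q).2 / 2,
       (sval q').2 <= (sval q).2 / 2 &
       forall y, mdist (sval q').1 y < 2 * (sval q').2 -> ~ B n y].
  case: q => -[x r] /= [Sx r0].
  have [y [Sy xy nBy]] : exists y, [/\ S y, mdist x y < r / 2 & ~ B n y].
    apply: contrapT => H; have [_ nx] := perfS x Sx; apply: nx.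
    have H' y : S y -> mdist x y < r / 2 -> B n y.
      by move=> Sy xy; apply: contrapT => nBy; apply: H; exists y.
    have Bx : B n x by apply: H' => //; rewrite mdistxx divr_gt0.
    exists (r / 2); first by rewrite divr_gt0.
    by move=> y Sy xy; apply: cliqueB Bx (H' y Sy xy).
  have [e e0 he] := closed_avoid (clB n) nBy.
  have m0 : 0 < Num.min (r / 2) (e / 2) by rewrite lt_min !divr_gt0.
  exists (exist _ (y, Num.min (r / 2) (e / 2)) (conj Sy m0)) => /=.
  split=> //; first by rewrite ge_min lexx.
  move=> z yz; apply: he; apply: lt_le_trans yz _.
  have : Num.min (r / 2) (e / 2) <= e / 2 by rewrite ge_min lexx orbT.
  lra.
have [f fP] := choice (fun p : nat * {q : X * R | S q.1 /\ 0 < q.2} => step p.1 p.2).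
pose q0 : {q : X * R | S q.1 /\ 0 < q.2} := exist _ (x0, 1) (conj Sx0 ltr01).
pose q := fix q n := if n is m.+1 then f (m, q m) else q0.
pose a n := (sval (q n)).1; pose r n := (sval (q n)).2.
have qS n : [/\ mdist (a n) (a n.+1) < r n / 2, r n.+1 <= r n / 2 &
    forall y, mdist (a n.+1) y < 2 * r n.+1 -> ~ B n y] by exact: (fP (n, q n)).
have rpos n : 0 < r n by have [] := svalP (q n).
have nest m n : (m <= n)%N -> mdist (a m) (a n) <= r m - r n.
  elim: n => [|n IH]; first by rewrite leqn0 => /eqP ->; rewrite mdistxx subrr.
  rewrite leq_eqVlt ltnS => /predU1P[->|/IH mn]; first by rewrite mdistxx subrr.
  by have [h1 h2 _] := qS n; have := metric_triangle (a m) (a n) (a n.+1); lra.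
have [n nP] : exists n, forall m, (n <= m)%N -> ~ [set: X] (a m).
  apply: (@compact_induction _ _ (fun A : set X =>
    exists n, forall m, (n <= m)%N -> ~ A (a m)) cX).
  - by exists 0%N => m _ [].
  - by move=> A A' AA' [n h]; exists n => m /h nA /AA'.
  - move=> A A' [n h] [n' h']; exists (maxn n n') => m.
    by rewrite geq_max => /andP[/h nA /h' nA'] [].
  - move=> x _; have [n Bnx] := covB x.
    have [_ _ hn] := qS n; have rn := rpos n.+1.
    exists [set y | mdist x y < r n.+1]; first exact: nbhs_mdist.
    exists n.+1 => m nm /= xm; apply: hn Bnx.
    have := nest _ _ nm; have := rpos m; have := metric_triangle (a n.+1) (a m) x.
    rewrite (metric_sym (a m) x); lra.
by apply: (nP n).
Qed.

Lemma clopen_in_closed M S : closed S -> clopen_in M S -> closed M.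
Proof.
move=> clS [MS [r r0 h]] x clx.
have [y [My /= xy]] := clx _ (nbhs_mdist x r0).
apply: (h y) => //; last by rewrite metric_sym.
by apply: clS; apply: closureS clx.
Qed.

Lemma tame_uniform M : closed M -> tame M -> exists2 r, 0 < r &
  forall x y, M x -> M y -> mdist x y < r -> short x y.
Proof.
move=> clM tM.
have [e e0 h] : exists2 e : R, 0 < e & forall y z, [set: X] y -> ball y e z ->
    M y -> M z -> short y z.
  apply: (lebesgue_number cX) => x _; have h0 := eta0.
  have [Mx|nMx] := pselect (M x).
    have [r r0 h] := tM x Mx.
    exists (Num.min r (eta / 2)); first by rewrite lt_min r0 divr_gt0.
    move=> y z; rewrite !ballEmdist /= !lt_min => /andP[xy xy'] /andP[xz xz'] My Mz.
    apply: short_trans (short_sym (h y My xy)) (h z Mz xz) _.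
    have := metric_triangle y x z; rewrite (metric_sym y x); lra.
  have [r r0 h] := closed_avoid clM nMx; exists r => // y z.
  by rewrite ballEmdist /= => /h nMy _ /nMy.
exists e => // x y Mx My xy; apply: h => //.
by rewrite ballEmdist.
Qed.

Definition nearby M nu := [set y | exists2 m, M m & mdist m y < nu].

Lemma projection M nu : exists f : X -> X, forall y, nearby M nu y ->
  M (f y) /\ mdist (f y) y < nu.
Proof.
have /choice[f fP] y : exists z, nearby M nu y -> M z /\ mdist z y < nu.
  have [[m Mm my]|nn] := pselect (nearby M nu y); first by exists m.
  by exists y.
by exists f.
Qed.

Inductive reach D S x : X -> Prop :=
| reach_refl : S x -> reach D S x x
| reach_step y z : reach D S x y -> S z -> D (y, z) -> reach D S x z.

Lemma reach_in D S x y : reach D S x y -> S y.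
Proof. by case. Qed.

Lemma reach_sub D D' S x y : D `<=` D' -> reach D S x y -> reach D' S x y.
Proof.
move=> DD'; elim=> [Sx|u v _ IH Sv uv]; first exact: reach_refl.
by apply: reach_step IH Sv _; exact: DD'.
Qed.

(** A small step from a point well inside the neighbourhood of [M] does not
    leave it. *)
Lemma reach_clopen D M S nu x : sym_entourage D -> 0 < nu ->
  reach D (S `&` nearby M nu) x `<=` nearby M (nu / 2) ->
  clopen_in (reach D (S `&` nearby M nu) x) S.
Proof.
move=> [entD syD] nu0 h; split; first by move=> y /reach_in[].
have [r r0 rD] := entourage_dist_lt entD.
exists (Num.min r (nu / 2)); first by rewrite lt_min r0 divr_gt0.
move=> y z ry Sz; rewrite lt_min => /andP[yz yz'].
apply: (reach_step ry _ (rD (y, z) yz)); split => //.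
have [m Mm my] := h _ ry; exists m => //.
have := metric_triangle m y z; lra.
Qed.

(** Along a D-chain that stays near [M], where [M] is uniformly a clique, the
    edge from a point to its projection to [M] is refinable at one end if and
    only if it is at the other: consecutive projections are short. *)
Lemma reach_edge D M S delta nu (f : X -> X) x y :
  sym_entourage D -> D `<=` E ->
  (forall a b, M a -> M b -> mdist a b < delta -> short a b) ->
  nu <= delta / 4 -> nu <= eta / 4 -> D `<=` dist_lt nu ->
  (forall a, S a -> M (f a) /\ mdist (f a) a < nu) ->
  reach D S x y -> edge D x (f x) <-> edge D y (f y).
Proof.
move=> sD DE hM nud nue Dnu hf; have e0 := eta0; elim=> [//|{}y z ry IH Sz yz].
rewrite {}IH; have {ry} Sy := reach_in ry.
have [[Mfy fyy] [Mfz fzz]] := (hf y Sy, hf z Sz).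
have yzd : mdist y z < nu := Dnu _ yz; have yz0 := mdist_ge0 y z.
have t1 := metric_triangle (f y) y (f z); have t2 := metric_triangle y z (f z).
have t3 := metric_triangle z y (f y).
rewrite (metric_sym z (f z)) in t2; rewrite (metric_sym z y) (metric_sym y (f y)) in t3.
have [_ /(_ D sD DE) eff] : short (f y) (f z) by apply: hM => //; lra.
have eyz : edge D y z by exact: edgeW.
split=> h.
  apply: (edge_trans sD DE (edge_sym sD eyz) _); last first.
    by rewrite metric_sym; lra.
  by apply: (edge_trans sD DE h eff); lra.
apply: (edge_trans sD DE eyz _); last by rewrite metric_sym; lra.
apply: (edge_trans sD DE h (edge_sym sD eff)); lra.
Qed.

Lemma edge_mono D D' x y : D' `<=` D -> edge D' x y -> edge D x y.
Proof. by move=> D'D [c cc h]; exists c => //; exact: chain_sub cc. Qed.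

(** Were [M] a tame clopen part of the derivative, take points x' of [S]
    tending to a point [x] of [M] without being short to it. Fine chains of [S]
    that start at x' and stay near [M] must either come back to [M] or leave,
    since otherwise the reachable set would be a tame clopen part of [S]; in
    both cases their end points accumulate at some z* that is short to them.
    Letting x' tend to [x] shows that the edge from z* to its projection to [M]
    is refinable, and then so is the edge from x' to [x]. *)
Lemma deriv_no_tame_part S :
  closed S -> no_tame_part S -> no_tame_part (deriv S).
Proof.
move=> clS noS M clopM [x Mx] tM.
have clM := clopen_in_closed (deriv_closed clS) clopM.
have [MdS [nu0 nu00 hnu0]] := clopM.
have [delta delta0 hdelta] := tame_uniform clM tM.
have [Sx nisox] := MdS x Mx; have e0 := eta0.
have [nu [nu_gt0 nu_nu0 nu_d nu_eta]] : exists nu : R,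
    [/\ 0 < nu, nu <= nu0 / 4, nu <= delta / 4 & nu <= eta / 4].
  exists (Num.min (nu0 / 4) (Num.min (delta / 4) (eta / 4))).
  by rewrite !lt_min !ge_min !divr_gt0//= !lexx /= !orbT.
have [f fP] := projection M nu.
set N := S `&` nearby M nu.
have fN a : N a -> M (f a) /\ mdist (f a) a < nu by move=> [_ /fP].
pose Q x' D z := reach D N x' z /\ (M z \/ ~ nearby M (nu / 2) z).
pose bad e x' := [/\ S x', mdist x x' < e & ~ short x x'].
have near_x x' : mdist x x' < nu -> nearby M nu x' by exists x.
have ends x' D : S x' -> mdist x x' < nu -> sym_entourage D -> exists z, Q x' D z.
  move=> Sx' xx' sD; apply: contrapT => H.
  have clopJ : clopen_in (reach D N x') S.
    apply: reach_clopen => // z rz; apply: contrapT => nz; apply: H.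
    by exists z; split => //; right.
  apply: (noS _ clopJ); first by exists x'; apply: reach_refl; split => //; exact: near_x.
  move=> y ry; have [Sy [m Mm my]] := reach_in ry.
  apply: (isolated_sub clopJ.1); apply: contrapT => nisoy; apply: H.
  by exists y; split => //; left; apply: (hnu0 m) => //; lra.
have [zs zsP] : exists zs, forall r e, 0 < r -> 0 < e -> exists2 x', bad e x' &
    forall D, sym_entourage D -> D `<=` E -> exists2 z, mdist zs z < r & Q x' D z.
  apply: contrapT => H.
  have [e e1 he] : exists2 e, 0 < e & forall x', bad e x' -> exists D,
      [/\ sym_entourage D, D `<=` E & forall z, [set: X] z -> ~ Q x' D z].
    apply: (@compact_induction _ _ (fun A : set X => exists2 e, 0 < e &
      forall x', bad e x' -> exists D, [/\ sym_entourage D, D `<=` E &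
        forall z, A z -> ~ Q x' D z]) cX).
    - by exists 1 => // x' _; exists E; split.
    - move=> A B AB [e e1 h]; exists e => // x' /h[D [sD DE hD]].
      by exists D; split => // z /AB; exact: hD.
    - move=> A B [e e1 h] [e' e1' h']; exists (Num.min e e'); first by rewrite lt_min e1.
      move=> x' [Sx']; rewrite lt_min => /andP[xe xe'] nsh.
      have [D [sD DE hD]] := h x' (And3 Sx' xe nsh).
      have [D' [sD' DE' hD']] := h' x' (And3 Sx' xe' nsh).
      exists (D `&` D'); split; first exact: sym_entourageI.
        by move=> p [/DE].
      move=> z [Az [rz oz]|Bz [rz oz]]; [apply: (hD z Az)|apply: (hD' z Bz)];
        by split => //; apply: reach_sub rz => p [].
    - move=> z _; apply: contrapT => nz; apply: H; exists z => r e r0 e1.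
      apply: contrapT => H2; apply: nz; exists [set y | mdist z y < r].
        exact: nbhs_mdist.
      exists e => // x' bx'; apply: contrapT => H3; apply: H2; exists x' => // D sD DE.
      apply: contrapT => H4; apply: H3; exists D; split => // y zy Qy.
      by apply: H4; exists y.
  have e2 : 0 < Num.min e nu by rewrite lt_min e1.
  have [x' bx' x'nu] : exists2 x', bad e x' & mdist x x' < nu.
    apply: contrapT => H2; apply: nisox; exists (Num.min e nu) => // y Sy.
    rewrite lt_min => /andP[ye ynu]; apply: contrapT => nsh; apply: H2.
    by exists y => //; split.
  have [D [sD DE hD]] := he x' bx'; have [Sx' _ _] := bx'.
  by have [z Qz] := ends x' D Sx' x'nu sD; apply: hD Qz.
have Szs : S zs.
  apply: closed_mdist => // r r0; have [x' _ /(_ E sE)[] // z zz [rz _]] := zsP r 1 r0 ltr01.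
  by exists z => //; case: (reach_in rz).
have [ms Mms mszs] : nearby M (2 * nu) zs.
  have [x' _ /(_ E sE)[] // z zz [rz _]] := zsP nu 1 nu_gt0 ltr01.
  have [_ [m Mm mz]] := reach_in rz; exists m => //.
  have := metric_triangle m z zs; rewrite (metric_sym z zs); lra.
have [r0 r00 hr0] : exists2 r0, 0 < r0 & forall z, S z ->
    M z \/ ~ nearby M (nu / 2) z -> mdist zs z < r0 -> short zs z.
  have [Mzs|nMzs] := pselect (M zs).
    have [r r_gt0 hr] := tM zs Mzs.
    exists (Num.min r (nu / 2)); first by rewrite lt_min r_gt0 divr_gt0.
    move=> z Sz oz; rewrite lt_min => /andP[zr znu]; apply: hr => //.
    by case: oz => // -[]; exists zs.
  have [r r_gt0 hr] : isolated S zs.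
    by apply: contrapT => niso; apply: nMzs; apply: (hnu0 ms) => //; lra.
  by exists r => // z Sz _; exact: hr.
pose r1 := Num.min r0 nu; have r1_gt0 : 0 < r1 by rewrite lt_min r00.
pose cut D := D `&` dist_lt nu.
have cutP D : sym_entourage D -> D `<=` E ->
    [/\ sym_entourage (cut D), cut D `<=` E, cut D `<=` D & cut D `<=` dist_lt nu].
  move=> sD DE; split; [exact: sym_entourageI sD (sym_dist_lt nu_gt0)| |by move=> p []..].
  by move=> p [/DE].
have link D x' z : sym_entourage D -> D `<=` E -> D `<=` dist_lt nu ->
    reach D N x' z -> edge D x' (f x') <-> edge D z (f z).
  by move=> sD DE Dnu; apply: (reach_edge sD DE hdelta nu_d nu_eta Dnu fN).
(* In the quadrilateral z, zs, ms, f z the sides from z to zs and from f z to ms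
   are short, so that the other two are refinable together. *)
have square z x' D : mdist zs z < r1 -> Q x' D z ->
    [/\ short zs z, short (f z) ms, mdist z (f z) < nu & mdist zs z < nu].
  rewrite lt_min => /andP[zr znu] [rz oz]; have Nz := reach_in rz.
  have [Mfz fz] := fN z Nz; have [Sz _] := Nz.
  split => //; [exact: hr0| |by rewrite metric_sym].
  apply: hdelta => //; have := metric_triangle (f z) z ms; have := metric_triangle z zs ms.
  rewrite (metric_sym z zs) (metric_sym zs ms); lra.
have sh_zs : short zs ms.
  split=> [|D sD DE]; first by rewrite metric_sym; lra.
  have [sD' D'E D'D D'nu] := cutP D sD DE.
  apply: (edge_mono D'D).
  have [e e_gt0 eD'] := entourage_dist_lt sD'.1.
  have e1 : 0 < Num.min e nu by rewrite lt_min e_gt0.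
  have [x' [Sx' + _] /(_ _ sD' D'E)[z zz Qz]] := zsP r1 _ r1_gt0 e1.
  rewrite lt_min => /andP[xe xnu].
  have [s1 s2 d1 d2] := square z x' _ zz Qz; have [rz _] := Qz.
  have Nx' : N x' by split => //; exact: near_x.
  have [Mfx' fx'] := fN x' Nx'.
  have s3 : short x (f x').
    by apply: hdelta => //; have := metric_triangle x x' (f x'); rewrite (metric_sym x' (f x')); lra.
  have ex' : edge (cut D) x' (f x').
    apply: (edge_trans sD' D'E _ (s3.2 _ sD' D'E)); last by rewrite metric_sym; lra.
    by apply: edgeW; apply: sD'.2; exact: (eD' (x, x')).
  have ez := (link _ _ _ sD' D'E D'nu rz).1 ex'.
  apply: (edge_trans sD' D'E (s1.2 _ sD' D'E)); last by rewrite metric_sym; lra.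
  apply: (edge_trans sD' D'E ez (s2.2 _ sD' D'E)).
  by have := metric_triangle z zs ms; rewrite (metric_sym z zs) (metric_sym zs ms); lra.
have [x' [Sx' xx' nsh] hx'] := zsP r1 nu r1_gt0 nu_gt0.
have Nx' : N x' by split => //; exact: near_x.
have [Mfx' fx'] := fN x' Nx'.
have sx'f : short x' (f x').
  split=> [|D sD DE]; first by rewrite metric_sym; lra.
  have [sD' D'E D'D D'nu] := cutP D sD DE.
  apply: (edge_mono D'D); have [z zz Qz] := hx' _ sD' D'E.
  have [s1 s2 d1 d2] := square z x' _ zz Qz; have [rz _] := Qz.
  apply/(link _ _ _ sD' D'E D'nu rz).
  apply: (edge_trans sD' D'E (edge_sym sD' (s1.2 _ sD' D'E))); last by lra.
  apply: (edge_trans sD' D'E (sh_zs.2 _ sD' D'E)).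
    exact: (edge_sym sD' (s2.2 _ sD' D'E)).
  by have := metric_triangle zs z (f z); lra.
apply: nsh; apply: short_trans (short_sym sx'f) _; last lra.
by apply: hdelta => //; have := metric_triangle x x' (f x'); rewrite (metric_sym x' (f x')); lra.
Qed.

(** Iterated derivatives of the space, continued by intersections at limit
    stages. *)
Inductive tower : set X -> Prop :=
| tower_setT : tower setT
| tower_deriv S : tower S -> tower (deriv S)
| tower_cap (F : set (set X)) : F !=set0 -> (forall S, F S -> tower S) ->
    tower (\bigcap_(S in F) S).

Lemma tower_closed S : tower S -> closed S.
Proof.
elim=> [|{}S _|F _ _ clF]; [exact: closedT|exact: deriv_closed|].
exact: closed_bigI.
Qed.

(** The stages are linearly ordered, with no stage strictly between [S] and
    its derivative. *)
Lemma tower_total S S' : tower S -> tower S' -> S `<=` S' \/ S' `<=` deriv S.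
Proof.
have capcase S0 (F : set (set X)) :
    (forall S1, F S1 -> S0 `<=` S1 \/ S1 `<=` deriv S0) ->
    S0 `<=` \bigcap_(S1 in F) S1 \/ \bigcap_(S1 in F) S1 `<=` deriv S0.
  move=> h; have [[S1 FS1 S1S0]|H] := pselect (exists2 S1, F S1 & S1 `<=` deriv S0).
    by right => y /(_ S1 FS1) /S1S0.
  left=> y S0y S1 FS1; case: (h S1 FS1) => [|S1S0]; first exact.
  by case: H; exists S1.
move=> tS; elim: tS S' => {S} [|S tS IHS|F F0 tF IHF] S' tS'.
- elim: tS' => [|S1 _ [h|h]|F _ _ h]; [by left|by right; exact: deriv_mono| |].
    by right; exact: subset_trans (@deriv_sub _) (subset_trans h (@subset_refl _ _)).
  exact: capcase.
- elim: tS' => [|S1 tS1 [h|h]|F _ _ h]; [by left| | |exact: capcase].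
    by case: (IHS S1 tS1) => h1; [left|right]; exact: deriv_mono.
  by right; exact: subset_trans (@deriv_sub _) h.
- elim: tS' => [|S1 tS1 [h|h]|G _ _ h]; [by left| | |exact: capcase].
    have [[S2 FS2 S2S1]|H] := pselect (exists2 S2, F S2 & S2 `<=` S1); last first.
      right; apply: deriv_mono => y S1y S2 FS2.
      case: (IHF S2 FS2 S1 tS1) => [S2S1|/(_ _ S1y)/deriv_sub//].
      by case: H; exists S2.
    have [[S3 FS3 S3d]|H] := pselect (exists2 S3, F S3 & S3 `<=` deriv S2).
      left=> y /(_ S3 FS3) /S3d; exact: deriv_mono.
    have capE : \bigcap_(S3 in F) S3 = S2.
      apply/seteqP; split=> [y /(_ _ FS2)//|y S2y S3 FS3].
      case: (IHF S2 FS2 S3 (tF _ FS3)) => [|S3d]; first exact.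
      by case: H; exists S3.
    rewrite capE; exact: IHF FS2 _ (tower_deriv tS1).
  by right; exact: subset_trans (@deriv_sub _) h.
Qed.

Lemma tower_chain S S' : tower S -> tower S' -> S `<=` S' \/ S' `<=` S.
Proof.
move=> tS tS'; case: (tower_total tS tS') => h; [by left|right].
exact: subset_trans h (@deriv_sub _).
Qed.

(** The members of [F] form a chain of compact sets. *)
Lemma cap_meets (F : set (set X)) (J : set X) : F !=set0 ->
  (forall S, F S -> tower S) -> closed J -> (forall S, F S -> S `&` J !=set0) ->
  (\bigcap_(S in F) S) `&` J !=set0.
Proof.
move=> [S0 FS0] tF clJ meets; apply: contrapT => H.
have [S FS SJ] : exists2 S, F S & forall y, [set: X] y -> S y -> ~ J y.
  apply: (@compact_induction _ _ (fun A : set X =>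
    exists2 S, F S & forall y, A y -> S y -> ~ J y) cX).
  - by exists S0.
  - by move=> A B AB [S FS h]; exists S => // y /AB; exact: h.
  - move=> A B [S FS h] [S' FS' h'].
    case: (tower_chain (tF S FS) (tF S' FS')) => SS'.
      by exists S => // y [Ay|By] Sy; [exact: h|apply: h' => //; exact: SS'].
    by exists S' => // y [Ay|By] Sy; [apply: h => //; exact: SS'|exact: h'].
  - move=> x _; have [Jx|nJx] := pselect (J x); last first.
      have [r r0 h] := closed_avoid clJ nJx.
      exists [set y | mdist x y < r]; first exact: nbhs_mdist.
      by exists S0 => // y /h.
    have [S FS nSx] : exists2 S, F S & ~ S x.
      apply: contrapT => H2; apply: H; exists x; split=> // S FS.
      by apply: contrapT => nSx; apply: H2; exists S.
    have [r r0 h] := closed_avoid (tower_closed (tF S FS)) nSx.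
    exists [set y | mdist x y < r]; first exact: nbhs_mdist.
    by exists S => // y /h.
by have [y [Sy Jy]] := meets S FS; exact: SJ Sy Jy.
Qed.

Section Tower.
Hypotheses (conX : connected [set: X]) (ntX : ~ tame setT).
Hypothesis not_perfect : forall S, closed S -> S !=set0 -> ~ (S `<=` deriv S).

Lemma setT_no_tame_part : no_tame_part setT.
Proof.
move=> M clopM M0 tM; apply: ntX; suff <- : M = setT by [].
have clM := clopen_in_closed closedT clopM; have [_ [r r0 h]] := clopM.
apply: conX => //; last by exists M => //; rewrite setTI.
exists M; last by rewrite setTI.
rewrite openE => x Mx; apply: filterS (nbhs_mdist x r0) => y.
exact: h.
Qed.

(** At a limit stage a tame clopen part [M] of the intersection has a
    neighbourhood [L] in some stage [S1]. If fine chains lead from every point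
    of [L] to [M], then all of [L] is short to [M], so [L] is tame. Otherwise
    some reachable set [J] is clopen and misses the intersection; the last
    stage that still meets [J] meets it in a tame clopen part. *)
Lemma cap_no_tame_part (F : set (set X)) : F !=set0 ->
  (forall S, F S -> tower S) ->
  (forall S S1, tower S -> F S1 -> S1 `<=` S -> no_tame_part S) ->
  no_tame_part (\bigcap_(S in F) S).
Proof.
move=> F0 tF noF M clopM [x Mx] tM; have tcap := tower_cap F0 tF.
have clM := clopen_in_closed (tower_closed tcap) clopM.
have [MF [nu0 nu00 hnu0]] := clopM; have e0 := eta0.
have [delta delta0 hdelta] := tame_uniform clM tM.
have [nu [nu_gt0 nu_nu0 nu_d nu_eta]] : exists nu : R,
    [/\ 0 < nu, nu <= nu0 / 4, nu <= delta / 4 & nu <= eta / 4].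
  exists (Num.min (nu0 / 4) (Num.min (delta / 4) (eta / 4))).
  by rewrite !lt_min !ge_min !divr_gt0//= !lexx /= !orbT.
have [f fP] := projection M nu.
have [S1 FS1 S1M] : exists2 S1, F S1 & forall y, [set: X] y -> S1 y ->
    nearby M nu y -> nearby M (nu / 2) y.
  apply: (@compact_induction _ _ (fun A : set X => exists2 S1, F S1 &
    forall y, A y -> S1 y -> nearby M nu y -> nearby M (nu / 2) y) cX).
  - by have [S FS] := F0; exists S.
  - by move=> A B AB [S FS h]; exists S => // y /AB; exact: h.
  - move=> A B [S FS h] [S' FS' h'].
    case: (tower_chain (tF S FS) (tF S' FS')) => SS'.
      by exists S => // y [Ay|By] Sy; [exact: h|apply: h' => //; exact: SS'].
    by exists S' => // y [Ay|By] Sy; [apply: h => //; exact: SS'|exact: h'].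
  - move=> y _; have [S FS] := F0.
    have [[S' FS' nSy]|H] := pselect (exists2 S', F S' & ~ S' y).
      have [r r0 h] := closed_avoid (tower_closed (tF S' FS')) nSy.
      exists [set z | mdist y z < r]; first exact: nbhs_mdist.
      by exists S' => // z /h.
    have capy : (\bigcap_(S in F) S) y.
      by move=> S' FS'; apply: contrapT => nSy; apply: H; exists S'.
    have nu20 : 0 < nu / 2 by rewrite divr_gt0.
    exists [set z | mdist y z < nu / 2]; first exact: nbhs_mdist.
    exists S => // z /= yz _ [m Mm mz]; exists y => //; apply: (hnu0 m) => //.
    have := metric_triangle m z y; rewrite (metric_sym z y); lra.
set L := S1 `&` nearby M nu.
have fL a : L a -> M (f a) /\ mdist (f a) a < nu by move=> [_ /fP].
have Lshort y : L y -> short y (f y).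
  move=> Ly; have [Mfy fyy] := fL y Ly; split; first by rewrite metric_sym; lra.
  move=> D sD DE; pose D' := D `&` dist_lt nu.
  have sD' : sym_entourage D' := sym_entourageI sD (sym_dist_lt nu_gt0).
  have D'D : D' `<=` D by move=> p [].
  have D'E := subset_trans D'D DE; have D'nu : D' `<=` dist_lt nu by move=> p [].
  apply: (edge_mono D'D).
  have [[z rz Mz]|nMJ] := pselect (exists2 z, reach D' L y z & M z).
    apply/(reach_edge sD' D'E hdelta nu_d nu_eta D'nu fL rz).
    have [Mfz fzz] := fL z (reach_in rz).
    have [_] : short z (f z) by apply: hdelta => //; rewrite metric_sym; lra.
    exact.
  exfalso; set J := reach D' L y in nMJ.
  have clopJ : clopen_in J S1.
    by apply: reach_clopen => // z /reach_in [S1z nz]; exact: S1M.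
  have Jy : J y by exact: reach_refl.
  have clJ := clopen_in_closed (tower_closed (tF _ FS1)) clopJ.
  pose FJ := [set S | tower S /\ S `&` J !=set0].
  have FJ1 : FJ S1 by split; [exact: tF|exists y; split => //; exact: clopJ.1].
  have tFJ S : FJ S -> tower S by move=> [].
  pose I := \bigcap_(S in FJ) S.
  have tI : tower I by apply: tower_cap => //; exists S1.
  have IJ : I `&` J !=set0 by apply: cap_meets => //; [exists S1|move=> S []].
  have IS1 : I `<=` S1 by move=> z /(_ _ FJ1).
  have dIJ z : J z -> ~ deriv I z.
    move=> Jz dIz.
    have FJd : FJ (deriv I) by split; [exact: tower_deriv|exists z].
    apply: (not_perfect (tower_closed tI)); last by move=> w /(_ _ FJd).
    by case: IJ => w [Iw _]; exists w.
  have [S2 FS2 IS2] : exists2 S2, F S2 & S2 `<=` I.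
    have [S2 FS2 S2J] : exists2 S2, F S2 & ~ (S2 `&` J !=set0).
      apply: contrapT => H.
      have [z [capz Jz]] : (\bigcap_(S in F) S) `&` J !=set0.
        apply: cap_meets => // S FS; apply: contrapT => SJ.
        by apply: H; exists S.
      apply: nMJ; exists z => //; have [_ [m Mm mz]] := reach_in Jz.
      by apply: (hnu0 m) => //; lra.
    exists S2 => //; case: (tower_chain tI (tF _ FS2)) => // h.
    by case: S2J; case: IJ => w [/h S2w Jw]; exists w.
  apply: (noF I S2 tI FS2 IS2 (I `&` J)) => //.
    split; first by move=> z [].
    have [_ [r r0 h]] := clopJ; exists r => // z w [Iz Jz] Iw zw.
    by split => //; apply: (h z) => //; exact: IS1.
  move=> z [Iz Jz]; apply: (@isolated_sub _ I); first by move=> w [].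
  by apply: contrapT => niso; apply: (dIJ z Jz).
apply: (noF S1 S1 (tF _ FS1) FS1 _ L); first by [].
- split; first by move=> y [].
  exists (nu / 2); first by rewrite divr_gt0.
  move=> y z [S1y ny] S1z yz; split => //; have [m Mm my] := S1M y I S1y ny.
  exists m => //; have := metric_triangle m y z; lra.
- exists x; split; first by apply: (MF x Mx).
  by exists x => //; rewrite mdistxx.
- move=> y Ly; exists nu => // z Lz yz.
  have [[Mfy fy] [Mfz fz]] := (fL y Ly, fL z Lz).
  have t1 := metric_triangle (f y) y (f z); have t2 := metric_triangle y z (f z).
  rewrite (metric_sym z (f z)) in t2.
  have s1 : short (f y) (f z) by apply: hdelta => //; lra.
  have s2 : short y (f z) by apply: short_trans (Lshort y Ly) s1 _; lra.
  by apply: short_trans s2 (short_sym (Lshort z Lz)) _; lra.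
Qed.

Lemma tower_no_tame_part S : tower S -> no_tame_part S.
Proof.
suff h : tower S -> forall S', tower S' -> S `<=` S' -> no_tame_part S'.
  by move=> tS; exact: h.
elim=> {S} [|S tS IH|F F0 tF IHF] S' tS' SS'.
- suff -> : S' = setT by exact: setT_no_tame_part.
  exact/seteqP.
- case: (tower_total tS tS') => [|S'd]; first exact: IH.
  suff -> : S' = deriv S by apply: deriv_no_tame_part; [exact: tower_closed|exact: IH].
  exact/seteqP.
- have [[S1 FS1 S1S']|H] := pselect (exists2 S1, F S1 & S1 `<=` S').
    exact: IHF S1S'.
  suff -> : S' = \bigcap_(S in F) S.
    by apply: cap_no_tame_part => // S0 S1 tS0 FS1; exact: IHF.
  apply/seteqP; split=> // y S'y S1 FS1.
  case: (tower_chain (tF _ FS1) tS') => [S1S'|]; last exact.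
  by case: H; exists S1.
Qed.

(** The last stage would be nonempty by compactness, yet equal to its own
    derivative. *)
Lemma tower_absurd : [set: X] !=set0 -> False.
Proof.
move=> X0.
have tn S : tower S -> S !=set0.
  elim=> {S} [//|S tS S0|F F0 tF nF].
    apply: contrapT => dS0; apply: (tower_no_tame_part tS _ S0).
      by split=> //; exists 1.
    by move=> x Sx; apply: contrapT => niso; apply: dS0; exists x.
  have := @cap_meets F setT F0 tF closedT; rewrite setIT; apply=> S FS.
  by rewrite setIT; exact: nF.
pose I := \bigcap_(S in tower) S.
have tI : tower I by apply: tower_cap => //; exists setT; exact: tower_setT.
apply: (not_perfect (tower_closed tI) (tn _ tI)) => x Ix.
exact: Ix (tower_deriv tI).
Qed.

End Tower.

End KrasinkiewiczMinc.

(** The tower excludes that [X] is not tame, and a tame compact space is a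
    clique at a uniform scale, which is the required condition. *)
Lemma joinable_weakly_chained (R : realType) (X : metricType R) :
  [set: X] !=set0 -> compact [set: X] -> connected [set: X] ->
  uniformly_joinable X -> weakly_chained X.
Proof.
move=> X0 cX conX uj; apply/weakly_chainedP; split.
  exact: connected_chain_connected.
move=> E sE; have [e e0 eE] := entourage_dist_lt sE.1.
pose eta := e / 8; have eta0 : 0 < eta by rewrite divr_gt0.
have etaE : dist_lt (8 * eta) `<=` E by rewrite /eta mulrC divfK.
have [B [clB covB cliqueB]] := clique_cover cX sE eta0 etaE X0 uj.
have tX : tame E eta [set: X].
  apply: contrapT => ntX; apply: (tower_absurd cX sE eta0 etaE conX ntX _ X0) => S.
  exact: deriv_not_perfect clB covB cliqueB.
have [r r0 hr] := tame_uniform cX sE eta0 etaE closedT tX.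
exists (dist_lt (Num.min r e)); split.
- by apply: sym_dist_lt; rewrite lt_min r0.
- by move=> p; rewrite /dist_lt /= lt_min => /andP[_ /eE].
- move=> x y; rewrite /dist_lt /= lt_min => /andP[xy _] D sD DE.
  by have [_] := hr x y I I xy; exact.
Qed.

(** * The Hilbert cube *)

Section Cube.
Context {R : realType}.
Local Notation Q := (hilbert_cube R).

Definition coord (q : Q) (l : nat) : R := set_val (q l).

Definition clamp (t : R) : R := Num.max 0 (Num.min 1 t).

Lemma clamp_ge0 t : 0 <= clamp t. Proof. by rewrite le_max lexx. Qed.

Lemma clamp_le1 t : clamp t <= 1.
Proof. by rewrite ge_max ler01 ge_min lexx. Qed.

Lemma clamp_mem t : `[0, 1]%classic (clamp t).
Proof. by rewrite /= in_itv /= clamp_ge0 clamp_le1. Qed.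

Lemma clamp_id t : 0 <= t -> t <= 1 -> clamp t = t.
Proof. by move=> t0 t1; rewrite /clamp (min_r t1) (max_r t0). Qed.

Lemma clamp_le0 t : t <= 0 -> clamp t = 0.
Proof.
by move=> t0; rewrite /clamp min_r ?max_l//; apply: le_trans t0 ler01.
Qed.

Lemma clamp_ge1 t : 1 <= t -> clamp t = 1.
Proof. by move=> t1; rewrite /clamp min_l// max_r. Qed.

Lemma clamp_continuous : continuous clamp.
Proof.
move=> t; apply: (@continuous_max R R (fun=> 0) (fun t => Num.min 1 t)).
  exact: cvg_cst.
by apply: (@continuous_min R R (fun=> 1) id); [exact: cvg_cst|exact: cvg_id].
Qed.

Lemma coord_mem q l : 0 <= coord q l <= 1.
Proof. by have := set_valP (q l); rewrite /= in_itv. Qed.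

Lemma coord_inj q q' : (forall l, coord q l = coord q' l) -> q = q'.
Proof. by move=> h; apply: functional_extensionality_dep => l; apply: val_inj; exact: h. Qed.

Lemma coord_continuous l : continuous (fun q : Q => coord q l).
Proof.
move=> q; pose I01 := (`[0, 1]%classic : set R).
apply: (@continuous_comp Q I01 R (fun q => q l) set_val q).
  exact: (@proj_continuous nat (fun=> I01) l q).
exact: (@initial_continuous I01 R set_val).
Qed.

(** The points of the cube are written in coordinates that need not be known
    in advance to lie between 0 and 1. *)
Definition cube_of (v : nat -> R) : Q := fun l => exist _ (clamp (v l)) (mem_set (clamp_mem (v l))).

Lemma coord_cube_of v l : 0 <= v l <= 1 -> coord (cube_of v) l = v l.
Proof. by move=> /andP[v0 v1]; rewrite /coord /= set_valE /= clamp_id. Qed.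

Definition agree (L : nat) (e : R) (u v : nat -> R) :=
  forall l, (l < L)%N -> `|u l - v l| < e.

Lemma agree_sub L L' e e' u v : (L <= L')%N -> e' <= e ->
  agree L' e' u v -> agree L e u v.
Proof.
move=> LL' ee' h l lL; apply: lt_le_trans ee'; apply: h; exact: leq_trans LL'.
Qed.

Lemma agreeC L e u v : agree L e u v -> agree L e v u.
Proof. by move=> h l /h; rewrite distrC. Qed.

Lemma agree_trans L e e' u v w : agree L e u v -> agree L e' v w ->
  agree L (e + e') u w.
Proof.
move=> h h' l lL; have := ler_normD (u l - v l) (v l - w l).
by rewrite addrA subrK => /le_lt_trans; apply; rewrite ltrD ?h ?h'.
Qed.

Lemma cube_nbhsP (q : Q) (U : set Q) : nbhs q U ->
  exists L e, 0 < e /\ forall q', agree L e (coord q) (coord q') -> U q'.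
Proof.
pose F : set_system Q := [set V | exists L e, 0 < e /\
  forall q', agree L e (coord q) (coord q') -> V q'].
have FF : Filter F.
  split.
  - by exists 0%N, 1.
  - move=> A B [L [e [e0 h]]] [L' [e' [e'0 h']]].
    exists (maxn L L'), (Num.min e e'); split; first by rewrite lt_min e0.
    by move=> q' ag; split; [apply: h|apply: h']; apply: agree_sub ag;
      rewrite ?leq_maxl ?leq_maxr ?ge_min ?lexx ?orbT.
  - by move=> A B AB [L [e [e0 h]]]; exists L, e; split => // q' /h /AB.
suff : F --> q by exact.
apply/(@pointwise_cvgP nat _ F q) => l V /= [_ [/= [W oW <-] Wql WV]].
have [e e0 he] : exists2 e : R, 0 < e & forall y, `|coord q l - y| < e -> W y.
  have /nbhs_ballP[e /= e0 he] : nbhs (coord q l) W by exact: open_nbhs_nbhs.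
  by exists e => // y; exact: he.
exists l.+1, e; split => // q' ag; apply: WV; apply: he; exact: ag.
Qed.

Lemma cube_continuous (T : topologicalType) (f : T -> Q) :
  (forall l, continuous (fun t => coord (f t) l)) -> continuous f.
Proof.
move=> cf t U /cube_nbhsP[L [e [e0 h]]].
suff : \forall t' \near t, agree L e (coord (f t)) (coord (f t')).
  by apply: filterS => t' /h.
have H l : \forall t' \near t, `|coord (f t) l - coord (f t') l| < e.
  have /cvgrPdist_lt := cf l t; exact.
elim: L {h} => [|L IH]; first exact: nearW.
apply: filterS2 IH (H L) => t' ag hL l.
by rewrite ltnS leq_eqVlt => /predU1P[->//|/ag].
Qed.

(** Precomposition with a retraction to [A] turns a map that is continuous on
    [A] into one that is continuous everywhere. *)
Lemma within_comp (S T U : topologicalType) (A : set T) (f : T -> U) (phi : S -> T) :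
  {within A, continuous f} -> continuous phi -> (forall s, A (phi s)) ->
  continuous (f \o phi).
Proof.
move=> /subspace_continuousP cf cphi Aphi s V /(cf _ (Aphi s)) nV.
have := cphi s _ nV; rewrite nbhs_simpl /=; apply: filterS => s' /= h.
exact: h.
Qed.

Lemma near_agree (T : topologicalType) (f : T -> Q) t L e : 0 < e ->
  {for t, continuous f} ->
  \forall t' \near t, agree L e (coord (f t)) (coord (f t')).
Proof.
move=> e0 cf; elim: L => [|L IH]; first exact: nearW.
have H : \forall t' \near t, `|coord (f t) L - coord (f t') L| < e.
  have : {for t, continuous (fun t => coord (f t) L)}.
    apply: (@continuous_comp _ _ _ f (fun q => coord q L)) => //.
    exact: coord_continuous.
  by move=> /cvgrPdist_lt; exact.
apply: filterS2 IH H => t' ag hL l.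
by rewrite ltnS leq_eqVlt => /predU1P[->//|/ag].
Qed.

Lemma uniform_agree (T : pseudoMetricType R) (K : set T) (f : T -> Q) L e :
  compact K -> continuous f -> 0 < e -> exists2 r : R, 0 < r &
  forall x y, K x -> ball x r y -> agree L e (coord (f x)) (coord (f y)).
Proof.
move=> cK cf e0; apply: (lebesgue_number cK) => x _.
have e20 : 0 < e / 2 by rewrite divr_gt0.
have /nbhs_ballP[r /= r0 h] := near_agree L e20 (cf x).
exists r => // y z /h xy /h xz; rewrite (splitr e).
exact: agree_trans (agreeC xy) xz.
Qed.

End Cube.

(** ** Metric compacta in the cube *)

Section Embedded.
Context {R : realType} {X : metricType R}.
Hypothesis cX : compact [set: X].
Variable e : X -> hilbert_cube R.
Hypothesis emb : embedding e.
Implicit Types (x y : X) (E : set (X * X)) (r : R).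

Lemma embedding_continuous : continuous e.
Proof.
apply/continuousP => B oB; apply/emb.2; by exists B.
Qed.

(** Off the diagonal two points are told apart by a coordinate, and near the
    diagonal they are E-close; by compactness finitely many coordinates do. *)
Lemma agree_entourage E : sym_entourage E -> exists L r, 0 < r /\
  forall x y, agree L r (coord (e x)) (coord (e y)) -> E (x, y).
Proof.
move=> sE; have [d d0 dE] := entourage_dist_lt sE.1.
have cXX : compact ([set: X] `*` [set: X]) by exact: compact_setX.
pose P (A : set (X * X)) := exists L r, 0 < r /\ forall x y, A (x, y) ->
  agree L r (coord (e x)) (coord (e y)) -> E (x, y).
suff [L [r [r0 h]]] : P ([set: X] `*` [set: X]).
  by exists L, r; split => // x y; exact: h.
apply: (@compact_induction _ _ P cXX).
- by exists 0%N, 1.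
- by move=> A B AB [L [r [r0 h]]]; exists L, r; split => // x y /AB; exact: h.
- move=> A B [L [r [r0 h]]] [L' [r' [r'0 h']]].
  exists (maxn L L'), (Num.min r r'); split; first by rewrite lt_min r0.
  move=> x y [Axy|Bxy] ag; [apply: h Axy _|apply: h' Bxy _];
    by apply: agree_sub ag; rewrite ?leq_maxl ?leq_maxr ?ge_min ?lexx ?orbT.
move=> [x y] _; have [<-|xy] := pselect (x = y).
  exists ([set x' | mdist x x' < d / 2] `*` [set x' | mdist x x' < d / 2]).
    exists ([set x' | mdist x x' < d / 2], [set x' | mdist x x' < d / 2]) => //.
    by split; apply: nbhs_mdist; rewrite divr_gt0.
  exists 0%N, 1; split => // x' y' [/= xx' xy'] _; apply: dE.
  by rewrite /dist_lt /=; have := metric_triangle x' x y'; rewrite (metric_sym x' x); lra.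
have [l exy] : exists l, coord (e x) l != coord (e y) l.
  apply: contrapT => H; apply: xy; apply: emb.1; apply: coord_inj => l.
  by apply: contrapT => nl; apply: H; exists l; exact/eqP.
pose r := `|coord (e x) l - coord (e y) l| / 3.
have r0 : 0 < r by rewrite divr_gt0// normr_gt0 subr_eq0.
exists ([set x' | agree l.+1 r (coord (e x)) (coord (e x'))] `*`
        [set y' | agree l.+1 r (coord (e y)) (coord (e y'))]).
  exists ([set x' | agree l.+1 r (coord (e x)) (coord (e x'))],
        [set y' | agree l.+1 r (coord (e y)) (coord (e y'))]) => //.
  by split; apply: near_agree => //; exact: embedding_continuous.
exists l.+1, r; split => // x' y' [/= xx' yy'] x'y'.
have := agree_trans xx' (agree_trans x'y' (agreeC yy')) (ltnSn l).
suff -> : r + (r + r) = `|coord (e x) l - coord (e y) l| by rewrite ltxx.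
rewrite /r; lra.
Qed.

Lemma dist_lt_agree L r : 0 < r -> exists2 d, 0 < d &
  forall x y, mdist x y < d -> agree L r (coord (e x)) (coord (e y)).
Proof.
move=> r0; have [d d0 h] := uniform_agree L cX embedding_continuous r0.
by exists d => // x y xy; apply: h; rewrite ?ballEmdist.
Qed.

Definition tube L r : set (hilbert_cube R) :=
  [set q | exists x, agree L r (coord q) (coord (e x))].

Lemma tube_nbhs L r : 0 < r -> set_nbhs (range e) (tube L r).
Proof.
move=> r0 _ [x _ <-]; have := @near_agree R (hilbert_cube R) id (e x) L r r0 (@cvg_id _ _).
by apply: filterS => q /= /agreeC ag; exists x.
Qed.

Lemma nbhs_tube U : set_nbhs (range e) U -> exists L r, 0 < r /\
  forall q x, agree L r (coord q) (coord (e x)) -> U q.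
Proof.
move=> nU.
pose P (A : set X) := exists L r, 0 < r /\ forall q x, A x ->
  agree L r (coord q) (coord (e x)) -> U q.
suff [L [r [r0 h]]] : P [set: X].
  by exists L, r; split => // q x; exact: h.
apply: (@compact_induction _ _ P cX).
- by exists 0%N, 1.
- by move=> A B AB [L [r [r0 h]]]; exists L, r; split => // q x /AB; exact: h.
- move=> A B [L [r [r0 h]]] [L' [r' [r'0 h']]].
  exists (maxn L L'), (Num.min r r'); split; first by rewrite lt_min r0.
  move=> q x [Ax|Bx] ag; [apply: h Ax _|apply: h' Bx _];
    by apply: agree_sub ag; rewrite ?leq_maxl ?leq_maxr ?ge_min ?lexx ?orbT.
move=> x _; have [L [r [r0 h]]] := cube_nbhsP (nU (e x) (imageT e x)).
have r20 : 0 < r / 2 by rewrite divr_gt0.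
exists [set y | agree L (r / 2) (coord (e x)) (coord (e y))].
  by apply: near_agree => //; exact: embedding_continuous.
exists L, (r / 2); split => // q y /= xy qy; apply: h; rewrite (splitr r).
exact: agree_trans xy (agreeC qy).
Qed.

End Embedded.

(** The distances to a dense sequence, truncated at 1, embed [X]. *)
Lemma compact_metric_embedding (R : realType) (X : metricType R) :
  compact [set: X] -> [set: X] !=set0 ->
  exists e : X -> hilbert_cube R, embedding e.
Proof.
move=> cX [p _].
have /choice[s sP] n : exists s : seq X, forall x,
    exists2 i, (i < size s)%N & mdist x (nth x s i) < n.+1%:R^-1.
  by apply: finite_net => //; rewrite invr_gt0.
pose a l := if unpickle l is Some (n, i) then nth p (s n) i else p.
have aP x (r : R) : 0 < r -> exists l, mdist (a l) x < r.
  move=> r0; pose n := Num.truncn r^-1.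
  have nr : n.+1%:R^-1 < r by rewrite invf_plt ?posrE// truncnS_gt.
  have [i si xi] := sP n x; exists (pickle (n, i)).
  rewrite /a pickleK metric_sym (set_nth_default x)//; exact: lt_trans xi nr.
pose e x : hilbert_cube R := cube_of (fun l => clamp (mdist (a l) x)).
have eE x l : coord (e x) l = clamp (mdist (a l) x).
  by rewrite coord_cube_of// clamp_ge0 clamp_le1.
have eball x (r : R) : 0 < r -> exists l (r' : R), coord (e x) l < r' /\
    forall y, coord (e y) l < r' -> mdist x y < r.
  move=> r0; pose r' := Num.min r 1 / 2.
  have r'0 : 0 < r' by rewrite divr_gt0// lt_min r0 ltr01.
  have r'r : r' <= r / 2 by rewrite ler_pM2r ?invr_gt0// ge_min lexx.
  have r'1 : r' <= 1 / 2 by rewrite ler_pM2r ?invr_gt0// ge_min lexx orbT.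
  have [l xl] := aP x r' r'0.
  have small y : coord (e y) l < r' -> mdist (a l) y < r'.
    rewrite eE; have [y1|/ltW y1] := leP (mdist (a l) y) 1.
      by rewrite clamp_id// mdist_ge0.
    by rewrite clamp_ge1//; lra.
  exists l, r'; split; first by rewrite eE clamp_id ?mdist_ge0//; lra.
  move=> y /small yl; have := metric_triangle x (a l) y; rewrite (metric_sym x (a l)); lra.
have ce : continuous e.
  apply: cube_continuous => l x; under eq_fun do rewrite eE.
  apply: (@continuous_comp _ _ _ (fun x => mdist (a l) x) clamp); last first.
    exact: clamp_continuous.
  apply/(@cvgrPdist_lt _ R^o) => d d0; apply: filterS (nbhs_mdist x d0) => y /= xy.
  have := metric_triangle (a l) x y; have := metric_triangle (a l) y x; rewrite (metric_sym y x).
  by move=> t1 t2; rewrite ltr_norml; apply/andP; split; lra.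
exists e; split.
  move=> x y exy; apply: contrapT => /eqP; rewrite -mdist_gt0 => d0.
  have [l [r' [xr' h]]] := eball x _ d0.
  by have := h y; rewrite -exy => /(_ xr'); rewrite ltxx.
move=> A; split=> [oA|[B oB ->]]; last exact: open_comp.
pose G := [set lr : nat * R | forall y, coord (e y) lr.1 < lr.2 -> A y].
exists (\bigcup_(lr in G) [set q | coord q lr.1 < lr.2]).
  apply: bigcup_open => -[l r] _ /=.
  have -> : [set q | coord q l < r] = (fun q : hilbert_cube R => coord q l) @^-1` [set t | t < r].
    by [].
  by apply: open_comp => [q _|]; [exact: coord_continuous|exact: open_lt].
apply/seteqP; split=> [x Ax|x [[l r] Glr /= xl]]; last exact: Glr.
have [r r0 xr] : exists2 r : R, 0 < r & forall y, mdist x y < r -> A y.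
  by apply: nbhs_mdistP; exact: open_nbhs_nbhs.
have [l [r' [xr' h]]] := eball x r r0.
by exists (l, r') => // y /h /xr.
Qed.

(** ** Polygons *)

Section Polygon.
Context {R : realType}.
Implicit Types (u v : nat -> R) (t : R).

(** The piecewise linear interpolation of [u 0, ..., u N] with nodes at
    [0, ..., N], extended by constants. *)
Fixpoint pl (u : nat -> R) (N : nat) (t : R) : R :=
  if N is n.+1 then (1 - clamp t) * u 0%N + clamp t * pl (u \o S) n (t - 1)
  else u 0%N.

Lemma pl_continuous u N : continuous (pl u N).
Proof.
elim: N u => [|N IH] u t /=; first exact: cvg_cst.
have cc := @clamp_continuous R t.
apply: (@cvgD _ R^o); apply: (@cvgM R).
- by apply: (@cvgB _ R^o) => //; exact: cvg_cst.
- exact: cvg_cst.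
- exact: cc.
- apply: (@continuous_comp _ _ _ (fun t => t - 1) (pl (u \o S) N)); last exact: IH.
  by apply: (@cvgB _ R^o); [exact: cvg_id|exact: cvg_cst].
Qed.

Lemma pl_le0 u N t : t <= 0 -> pl u N t = u 0%N.
Proof. by case: N => [//|N] t0 /=; rewrite clamp_le0// subr0 mul0r addr0 mul1r. Qed.

Lemma pl_end u N t : N%:R <= t -> pl u N t = u N.
Proof.
elim: N u t => [//|N IH] u t /=; rewrite -natr1 => Nt.
have N0 : (0 : R) <= N%:R by [].
rewrite clamp_ge1; last lra.
by rewrite subrr mul0r add0r mul1r IH//=; lra.
Qed.

Lemma pl_segment u N j t : (j < N)%N -> j%:R <= t -> t <= j.+1%:R ->
  pl u N t = (1 - (t - j%:R)) * u j + (t - j%:R) * u j.+1.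
Proof.
elim: N u j t => [//|N IH] u [|j] t /= jN jt tj.
  by rewrite clamp_id// pl_le0 ?subr_le0//= subr0.
have j0 : (0 : R) <= j%:R by [].
move: jt tj; rewrite -!natr1 => jt tj; rewrite clamp_ge1; last lra.
rewrite subrr mul0r add0r mul1r (IH _ j)//=; [|lra|by rewrite -natr1; lra].
by congr (_ * _ + _ * _); lra.
Qed.

Lemma pl_stable u N N' t : (N <= N')%N -> (forall j, (N <= j)%N -> u j = u N) ->
  pl u N' t = pl u N t.
Proof.
elim: N' N u t => [|N' IH] [|N] u t //= NN' uN.
  rewrite (IH 0%N)//=; last by move=> j _; rewrite /= !(uN _.+1).
  by rewrite (uN 1%N)// -mulrDl subrK mul1r.
by rewrite (IH N)//= => j Nj; exact: uN.
Qed.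

Lemma pl_range u N t : (forall j, 0 <= u j <= 1) -> 0 <= pl u N t <= 1.
Proof.
elim: N u t => [//|N IH] u t h /=; first exact: h.
have c0 := clamp_ge0 t; have c1 := clamp_le1 t.
have /andP[a0 a1] := h 0%N.
have /andP[b0 b1] := IH (u \o S) (t - 1) (fun j => h j.+1).
by apply/andP; split; nra.
Qed.

(** [t] lies on the segment that starts at the node [j]; the last segment is
    the infinite one beyond [N]. *)
Definition node (N j : nat) t := (j <= N)%N /\
  (j%:R <= t /\ ((j < N)%N -> t <= j.+1%:R)).

Lemma node_ex N t : 0 <= t -> exists j, node N j t.
Proof.
move=> t0; have [Nt|tN] := leP N%:R t.
  by exists N; split => //; rewrite ltnn.
have /andP[tr1 tr2] := truncn_itv t0.
exists (Num.truncn t); split; last by split => // _; exact: ltW.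
by rewrite -(ler_nat R); apply: le_trans tr1 (ltW tN).
Qed.

Lemma convex_near (a b w r s : R) : 0 <= s -> s <= 1 ->
  `|a - w| < r -> `|b - w| < r -> `|(1 - s) * a + s * b - w| < r.
Proof.
move=> s0 s1 ar br; pose m := Num.max `|a - w| `|b - w|.
have mr : m < r by rewrite gt_max ar.
apply: le_lt_trans mr.
have /andP[a1 a2] : - m <= a - w <= m by rewrite -ler_norml le_max lexx.
have /andP[b1 b2] : - m <= b - w <= m by rewrite -ler_norml le_max lexx orbT.
have t0 : 0 <= 1 - s by rewrite subr_ge0.
have := mulr_ge0 s0 (_ : 0 <= b - w + m); have := mulr_ge0 s0 (_ : 0 <= m - (b - w)).
have := mulr_ge0 t0 (_ : 0 <= a - w + m); have := mulr_ge0 t0 (_ : 0 <= m - (a - w)).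
move=> /(_ ltac:(lra)) e1 /(_ ltac:(lra)) e2 /(_ ltac:(lra)) e3 /(_ ltac:(lra)) e4.
by rewrite ler_norml; apply/andP; split; lra.
Qed.

Lemma pl_near u N j t w r : node N j t -> `|u j - w| < r ->
  ((j < N)%N -> `|u j.+1 - w| < r) -> `|pl u N t - w| < r.
Proof.
move=> [+ [jt tj]]; rewrite leq_eqVlt => /predU1P[jN|jN] uj uj1.
  by rewrite pl_end -?jN.
have t1 := tj jN; rewrite (pl_segment _ jN jt t1); apply: convex_near => //.
- by rewrite subr_ge0.
- by move: t1; rewrite -natr1; lra.
- exact: uj1.
Qed.

End Polygon.

(** * Weakly chained continua are pointed 1-movable *)

Section Deformation.
Context {R : realType} {X : metricType R}.
Variables (e : X -> hilbert_cube R) (x0 : X) (L : nat) (eps : R).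
Hypothesis eps0 : 0 < eps.
Implicit Types (x y z : X) (E : set (X * X)) (c : seq X) (gam del : nat -> R -> R).

Local Notation near_X v := (exists x, agree L eps v (coord (e x))).

(** Loops at [e x0] and their homotopies are handled in coordinates and for all
    real times, so that they can be added as real functions. *)
Definition curve gam := [/\ forall l, continuous (gam l),
  forall l, gam l 0 = coord (e x0) l, forall l, gam l 1 = coord (e x0) l &
  forall t, 0 <= t <= 1 -> (forall l, 0 <= gam l t <= 1) /\ near_X (gam^~ t)].

Definition deform gam del := exists H : nat -> R * R -> R,
  [/\ forall l, continuous (H l),
      forall l t, 0 <= t <= 1 -> H l (0, t) = gam l t /\ H l (1, t) = del l t,
      forall l s, 0 <= s <= 1 ->
        H l (s, 0) = coord (e x0) l /\ H l (s, 1) = coord (e x0) l &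
      forall s t, 0 <= s <= 1 -> 0 <= t <= 1 ->
        (forall l, 0 <= H l (s, t) <= 1) /\ near_X (H^~ (s, t))].

Lemma deform_sym gam del : deform gam del -> deform del gam.
Proof.
move=> [H [cH H01 Hends Hr]]; exists (fun l st => H l (1 - st.1, st.2)).
have sym01 (s : R) : 0 <= s <= 1 -> 0 <= 1 - s <= 1.
  by move=> /andP[s0 s1]; apply/andP; split; lra.
split.
- move=> l st; apply: (@continuous_comp _ _ _ (fun st : R * R => (1 - st.1, st.2)) (H l)).
    apply: (@cvg_pair _ _ _ _ (nbhs (1 - st.1)) (nbhs st.2)); last exact: cvg_snd.
    by apply: (@cvgB _ R^o); [exact: cvg_cst|exact: cvg_fst].
  exact: cH.
- by move=> l t t01 /=; rewrite subr0 subrr; have [] := H01 l t t01.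
- by move=> l s /sym01 /(Hends l).
- by move=> s t /sym01 s01 t01; exact: Hr.
Qed.

(** As the second homotopy starts where the first one ends, running them one
    after the other is the sum of the two, each stopped at its end, minus the
    intermediate curve; in this form continuity is immediate. *)
Lemma deform_trans gam del rho : deform gam del -> deform del rho -> deform gam rho.
Proof.
move=> [H [cH H01 Hends Hr]] [K [cK K01 Kends Kr]].
pose G l (st : R * R) := H l (clamp (2 * st.1 - 0), st.2) +
  K l (clamp (2 * st.1 - 1), st.2) - H l (1, st.2).
have HK l t : 0 <= t <= 1 -> K l (0, t) = H l (1, t).
  by move=> t01; have [_ ->] := H01 l t t01; have [-> _] := K01 l t t01.
have GE s : 0 <= s <= 1 -> (exists2 s', 0 <= s' <= 1 & forall l t, 0 <= t <= 1 ->
      G l (s, t) = H l (s', t)) \/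
    (exists2 s', 0 <= s' <= 1 & forall l t, 0 <= t <= 1 -> G l (s, t) = K l (s', t)).
  move=> /andP[s0 s1]; have [sh|/ltW sh] := leP s (1 / 2); [left|right].
    exists (2 * s); first by apply/andP; split; lra.
    move=> l t t01; rewrite /G /= subr0 clamp_id; [|lra..].
    by rewrite clamp_le0 ?HK// ?addrK//; lra.
  exists (2 * s - 1); first by apply/andP; split; lra.
  move=> l t t01; rewrite /G /= subr0 clamp_ge1; last lra.
  by rewrite clamp_id; [rewrite addrC addKr|lra..].
exists G; split.
- move=> l st.
  have cc (b : R) : continuous (fun st : R * R => (clamp (2 * st.1 - b), st.2)).
    move=> {}st; apply: (@cvg_pair _ _ _ _ (nbhs (clamp (2 * st.1 - b))) (nbhs st.2)).
      apply: (@continuous_comp _ _ _ (fun st : R * R => 2 * st.1 - b) clamp).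
        apply: (@cvgB _ R^o); last exact: cvg_cst.
        by apply: (@cvgM R); [exact: cvg_cst|exact: cvg_fst].
      exact: clamp_continuous.
    exact: cvg_snd.
  apply: (@cvgB _ R^o); first apply: (@cvgD _ R^o).
  + exact: (@continuous_comp _ _ _ (fun st : R * R => (clamp (2 * st.1 - 0), st.2))
      (H l) st (cc 0 st) (cH l _)).
  + exact: (@continuous_comp _ _ _ (fun st : R * R => (clamp (2 * st.1 - 1), st.2))
      (K l) st (cc 1 st) (cK l _)).
  + have c1 : {for st, continuous (fun st : R * R => (1 : R, st.2))}.
      apply: (@cvg_pair _ _ _ _ (nbhs (1 : R)) (nbhs st.2)); last exact: cvg_snd.
      exact: cvg_cst.
    exact: (@continuous_comp _ _ _ (fun st : R * R => (1 : R, st.2)) (H l) st c1 (cH l _)).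
- move=> l t t01; have l0 : (0 <= 0 :> R) && (0 <= 1 :> R) by rewrite lexx ler01.
  have l1 : (0 <= 1 :> R) && (1 <= 1 :> R) by rewrite lexx ler01.
  rewrite /G /= !mulr0 !mulr1 !subr0 sub0r (clamp_le0 (t := -1)); last lra.
  rewrite (clamp_le0 (t := 0))// HK// addrK; split; first by have [] := H01 l t t01.
  rewrite !clamp_ge1; [|lra..].
  by rewrite addrC addKr; have [_] := K01 l t t01.
- move=> l s s01; have l0 : (0 <= 0 :> R) && (0 <= 1 :> R) by rewrite lexx ler01.
  have l1 : (0 <= 1 :> R) && (1 <= 1 :> R) by rewrite lexx ler01.
  by case: (GE s s01) => -[s' s'01 E]; rewrite !E//; [exact: Hends|exact: Kends].
- move=> s t s01 t01; case: (GE s s01) => -[s' s'01 E].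
    have [h1 [x h2]] := Hr s' t s'01 t01; split; first by move=> l; rewrite E.
    by exists x => l lL; rewrite E//; exact: h2.
  have [h1 [x h2]] := Kr s' t s'01 t01; split; first by move=> l; rewrite E.
  by exists x => l lL; rewrite E//; exact: h2.
Qed.

Lemma deform_straight gam del : curve gam -> curve del ->
  (forall t, 0 <= t <= 1 -> exists x,
     agree L eps (gam^~ t) (coord (e x)) /\ agree L eps (del^~ t) (coord (e x))) ->
  deform gam del.
Proof.
move=> [cg g0 g1 gr] [cd d0 d1 dr] near.
exists (fun l st => (1 - st.1) * gam l st.2 + st.1 * del l st.2); split.
- move=> l st; apply: (@cvgD _ R^o); apply: (@cvgM R).
  + by apply: (@cvgB _ R^o); [exact: cvg_cst|exact: cvg_fst].
  + by apply: (@continuous_comp _ _ _ snd (gam l)); [exact: cvg_snd|exact: cg].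
  + exact: cvg_fst.
  + by apply: (@continuous_comp _ _ _ snd (del l)); [exact: cvg_snd|exact: cd].
- by move=> l t _ /=; rewrite subr0 subrr !mul1r !mul0r addr0 add0r.
- by move=> l s _ /=; rewrite g0 g1 d0 d1 -!mulrDl subrK !mul1r.
- move=> s t /andP[s0 s1] t01; have [gr1 _] := gr t t01; have [dr1 _] := dr t t01.
  split=> [l|]; last first.
    have [x [gx dx]] := near t t01; exists x => l lL.
    by apply: convex_near => //; [exact: gx|exact: dx].
  have /andP[a0 a1] := gr1 l; have /andP[b0 b1] := dr1 l.
  by apply/andP; split => /=; nra.
Qed.

Definition vertices c l (j : nat) := coord (e (nth x0 c j)) l.

(** The polygon through the chain [c], run at speed [k]; it rests at [x0] once
    it has reached the end of [c]. *)
Definition polygon c (N k : nat) l (t : R) := pl (vertices c l) N (k%:R * t).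

Lemma chain_nth E x y c : sym_entourage E -> is_chain E x y c ->
  [/\ nth y c 0 = x, forall j, E (nth y c j, nth y c j.+1) &
      forall j, (size c <= j.+1)%N -> nth y c j = y].
Proof.
move=> sE; elim/(@chain_ind X E) => {x y c} [x|x x' y c xx' cc [c0 cj cN]].
  by split=> [//|[|j]|[|j]] /=; rewrite ?nth_nil//; exact: sym_refl.
split=> [//|[|j]|[|j]] /=; [by rewrite c0|exact: cj| |exact: cN].
by case: c cc {c0 cj cN} => // -[].
Qed.

Section ChainPolygon.
Variable E : set (X * X).
Hypothesis sE : sym_entourage E.
Hypothesis Eagree : forall x y, E (x, y) -> agree L eps (coord (e x)) (coord (e y)).

Lemma polygon_continuous c N k l : continuous (polygon c N k l).
Proof.
move=> t; have ct : {for t, continuous (fun t : R => k%:R * t)}.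
  by apply: (@cvgM R); [exact: cvg_cst|exact: cvg_id].
exact: (@continuous_comp R R R _ (pl (vertices c l) N) t ct (@pl_continuous _ _ _ _)).
Qed.

Lemma polygon_near c N k t : is_chain E x0 x0 c -> 0 <= t -> exists j,
  node N j (k%:R * t) /\ agree L eps ((polygon c N k)^~ t) (coord (e (nth x0 c j))).
Proof.
move=> cc t0; have kt : 0 <= k%:R * t by rewrite mulr_ge0.
have [j nj] := node_ex N kt; exists j; split=> // l lL.
have [_ cj _] := chain_nth sE cc.
apply: (pl_near nj); first by rewrite subrr normr0.
by move=> _; apply: (agreeC (Eagree (cj j))).
Qed.

Lemma polygon_curve c N k : is_chain E x0 x0 c ->
  (size c <= N.+1)%N -> (N <= k)%N -> curve (polygon c N k).
Proof.
move=> cc cN Nk; have [c0 cj cend] := chain_nth sE cc; split.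
- exact: polygon_continuous.
- by move=> l; rewrite /polygon mulr0 pl_le0// /vertices c0.
- move=> l; rewrite /polygon mulr1 pl_end ?ler_nat// /vertices cend//.
- move=> t /andP[t0 t1]; split; first by move=> l; apply: pl_range => j; exact: coord_mem.
  by have [j [_ h]] := polygon_near N k cc t0; exists (nth x0 c j).
Qed.

(** Changing the speed slides each point along the polygon. *)
Lemma deform_speed c n k : is_chain E x0 x0 c -> (size c <= n.+1)%N ->
  (n <= k)%N -> deform (polygon c n n) (polygon c n k).
Proof.
move=> cc cn nk; have [c0 cj cend] := chain_nth sE cc.
pose tau (st : R * R) : R := ((1 - st.1) * n%:R + st.1 * k%:R) * st.2.
have nkR : (n%:R : R) <= k%:R by rewrite ler_nat.
have n0 : (0 : R) <= n%:R by [].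
exists (fun l st => pl (vertices c l) n (tau st)); split.
- move=> l st; have ct : {for st, continuous tau}.
    apply: (@cvgM R); last exact: cvg_snd.
    apply: (@cvgD _ R^o); apply: (@cvgM R); try exact: cvg_cst; last exact: cvg_fst.
    by apply: (@cvgB _ R^o); [exact: cvg_cst|exact: cvg_fst].
  exact: (@continuous_comp _ R R tau (pl (vertices c l) n) st ct (@pl_continuous _ _ _ _)).
- by move=> l t _; rewrite /polygon /tau /= subr0 subrr !mul1r !mul0r addr0 add0r.
- move=> l s /andP[s0 s1]; rewrite /tau /= mulr0 mulr1 pl_le0//; split.
    by rewrite /vertices c0.
  by rewrite pl_end; [rewrite /vertices cend|nra].
- move=> s t /andP[s0 s1] /andP[t0 t1].
  split; first by move=> l; apply: pl_range => j; exact: coord_mem.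
  have tau0 : 0 <= tau (s, t).
    by rewrite /tau /= mulr_ge0// addr_ge0// mulr_ge0//; lra.
  have [j nj] := node_ex n tau0; exists (nth x0 c j) => l lL.
  apply: (pl_near nj); first by rewrite subrr normr0.
  by move=> _; apply: (agreeC (Eagree (cj j))).
Qed.

(** A vertex of the shorter chain is E-close to both ends of the edge that the
    polygon of the longer chain runs through at the same time. *)
Lemma hom_deform c c' : chain_homotopic E x0 x0 c c' -> is_chain E x0 x0 c ->
  exists N0, forall N, (N0 <= N)%N -> deform (polygon c N N) (polygon c' N N).
Proof.
move=> h; have [_] : (is_chain E x0 x0 c <-> is_chain E x0 x0 c') /\
  (is_chain E x0 x0 c ->
   exists N0, forall N, (N0 <= N)%N -> deform (polygon c N N) (polygon c' N N)); last exact.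
elim/(@hom_ind X E): h => {c c'}.
- move=> c; split=> // cc; exists (size c) => N cN.
  have pc := polygon_curve cc (leqW cN) (leqnn N).
  by apply: deform_straight => // t /andP[t0 _]; have [j [_ hj]] := polygon_near N N cc t0; exists (nth x0 c j).
- move=> c d [ecd hcd]; split; first by tauto.
  move=> /ecd /hcd [N0 hN]; exists N0 => N /hN; exact: deform_sym.
- move=> c d f [ecd hcd] [edf hdf]; split; first by tauto.
  move=> cc; have [N0 h0] := hcd cc; have [N1 h1] := hdf (ecd.1 cc).
  exists (maxn N0 N1) => N; rewrite geq_max => /andP[/h0 + /h1]; exact: deform_trans.
- move=> s z t c1 c2; split=> // _; exists (size (s ++ z :: t)) => N sN.
  have sN1 : (size (s ++ t) <= N)%N.
    by apply: leq_trans sN; rewrite !size_cat /= leq_add2l.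
  apply: deform_straight.
  + exact: polygon_curve c1 (leqW sN1) (leqnn N).
  + exact: polygon_curve c2 (leqW sN) (leqnn N).
  move=> tt /andP[t0 _]; have [j [nj hj]] := polygon_near N N c1 t0.
  exists (nth x0 (s ++ t) j); split => // l lL.
  have [_ cj _] := chain_nth sE c2.
  have [js|sj] := ltnP j (size s).
    have E1 : nth x0 (s ++ t) j = nth x0 (s ++ z :: t) j by rewrite !nth_cat js.
    rewrite E1; apply: (pl_near nj); first by rewrite subrr normr0.
    by move=> _; apply: (agreeC (Eagree (cj j))).
  have E1 : nth x0 (s ++ t) j = nth x0 (s ++ z :: t) j.+1.
    by rewrite !nth_cat ltnNge sj /= ltnNge leqW// subSn.
  rewrite E1; apply: (pl_near nj); first by apply: (Eagree (cj j)).
  by move=> _; rewrite subrr normr0.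
Qed.

End ChainPolygon.

Lemma deform_homotopic (U : set (hilbert_cube R)) (g h : R -> hilbert_cube R) gam del :
  (forall q x, agree L eps (coord q) (coord (e x)) -> U q) ->
  (forall t l, 0 <= t <= 1 -> coord (g t) l = gam l t) ->
  (forall t l, 0 <= t <= 1 -> coord (h t) l = del l t) ->
  deform gam del -> loop_homotopic_in U (e x0) g h.
Proof.
move=> UP gE hE [H [cH H01 Hends Hr]].
exists (fun st => cube_of (H^~ st)).
have in01 (t : R) : `[0, 1]%classic t -> 0 <= t <= 1 by rewrite /= in_itv.
have i0 : (0 <= 0 :> R) && (0 <= 1 :> R) by rewrite lexx ler01.
have i1 : (0 <= 1 :> R) && (1 <= 1 :> R) by rewrite lexx ler01.
have HE s t l : 0 <= s <= 1 -> 0 <= t <= 1 -> coord (cube_of (H^~ (s, t))) l = H l (s, t).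
  by move=> s01 t01; rewrite coord_cube_of//; have [] := Hr s t s01 t01.
split.
- apply: continuous_subspaceT; apply: cube_continuous => l st.
  apply: (@continuous_comp _ _ _ (H l) clamp); first exact: cH.
  exact: clamp_continuous.
- by move=> t /in01 t01; split; apply: coord_inj => l; rewrite HE// ?gE// ?hE//;
    have [] := H01 l t t01.
- by move=> s /in01 s01; split; apply: coord_inj => l; rewrite HE//;
    have [] := Hends l s s01.
- move=> s t /in01 s01 /in01 t01; have [_ [x hx]] := Hr s t s01 t01.
  by apply: (UP _ x) => l lL; rewrite HE//; exact: hx.
Qed.

End Deformation.

Section Movable.
Context {R : realType} {X : metricType R}.
Hypothesis cX : compact [set: X].
Variables (e : X -> hilbert_cube R) (x0 : X).
Hypothesis emb : embedding e.
Implicit Types (x y : X) (E F D : set (X * X)) (c : seq X).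

(** The Mittag-Leffler condition on the groups of E-loops at [x0]. *)
Definition loops_refine E F := forall c D, is_chain F x0 x0 c ->
  sym_entourage D -> D `<=` E -> refinable E D x0 x0 c.

Lemma loop_uniform (g : R -> hilbert_cube R) L (r : R) :
  {within `[0, 1], continuous g} -> 0 < r ->
  exists2 d : R, 0 < d & forall s t : R, 0 <= s <= 1 -> 0 <= t <= 1 ->
    `|s - t| < d -> agree L r (coord (g s)) (coord (g t)).
Proof.
move=> cg r0.
have cgc := within_comp cg (@clamp_continuous R) (@clamp_mem R).
have [d d0 h] := uniform_agree L (@segment_compact R 0 1) cgc r0.
exists d => // s t /[dup] s01 /andP[s0 s1] /andP[t0 t1] st.
have := h s t _ st; rewrite /comp !clamp_id//; apply.
by rewrite /= in_itv.
Qed.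

Lemma homotopy_uniform (H : R * R -> hilbert_cube R) L (r : R) :
  {within `[0, 1] `*` `[0, 1], continuous H} -> 0 < r ->
  exists2 d : R, 0 < d & forall s t s' t' : R,
    0 <= s <= 1 -> 0 <= t <= 1 -> 0 <= s' <= 1 -> 0 <= t' <= 1 ->
    `|s - s'| < d -> `|t - t'| < d ->
    agree L r (coord (H (s, t))) (coord (H (s', t'))).
Proof.
move=> cH r0; pose phi (p : R * R) := (clamp p.1, clamp p.2).
have cphi : continuous phi.
  move=> p; apply: (@cvg_pair _ _ _ _ (nbhs (clamp p.1)) (nbhs (clamp p.2))).
    by apply: (@continuous_comp _ _ _ fst clamp); [exact: cvg_fst|exact: clamp_continuous].
  by apply: (@continuous_comp _ _ _ snd clamp); [exact: cvg_snd|exact: clamp_continuous].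
have cHc := within_comp cH cphi (fun p => conj (clamp_mem p.1) (clamp_mem p.2)).
have cI := compact_setX (@segment_compact R 0 1) (@segment_compact R 0 1).
have [d d0 h] := uniform_agree L cI cHc r0.
exists d => // s t s' t' s01 t01 s'01 t'01 ss' tt'.
have := h (s, t) (s', t') _ (conj ss' tt'); rewrite /comp /phi /=.
case/andP: (s01) => s0 s1; case/andP: (t01) => t0 t1.
case/andP: s'01 => s'0 s'1; case/andP: t'01 => t'0 t'1.
by rewrite !clamp_id//; apply; rewrite !in_itv /= s01 t01.
Qed.

Lemma inv_nat_lt (d : R) (N : nat) : 0 < d ->
  exists n, [/\ (N <= n)%N, (0 < n)%N & n%:R^-1 < d].
Proof.
move=> d0; exists (maxn N (Num.truncn d^-1).+1).
rewrite leq_maxl leq_max orbT; split=> //.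
rewrite invf_plt ?posrE ?ltr0n ?leq_max ?orbT//.
by apply: lt_le_trans (truncnS_gt _) _; rewrite ler_nat leq_maxr.
Qed.

Lemma frac01 (j n : nat) : (0 < n)%N -> (j <= n)%N -> 0 <= (j%:R / n%:R : R) <= 1.
Proof.
move=> n0 jn; rewrite divr_ge0//=.
by rewrite ler_pdivrMr ?ltr0n// mul1r ler_nat.
Qed.

Lemma frac_step (j n : nat) : (0 < n)%N ->
  `|j%:R / n%:R - j.+1%:R / n%:R| = n%:R^-1 :> R.
Proof.
move=> n0; rewrite -mulrBl -natr1 opprD addrA subrr sub0r mulN1r normrN.
by rewrite ger0_norm.
Qed.

Lemma polygon_loop_in (W : set (hilbert_cube R)) L (r : R) E c N :
  0 < r -> sym_entourage E ->
  (forall x y, E (x, y) -> agree L r (coord (e x)) (coord (e y))) ->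
  (forall q x, agree L r (coord q) (coord (e x)) -> W q) ->
  is_chain E x0 x0 c -> (size c <= N.+1)%N ->
  loop_in W (e x0) (fun t => cube_of ((polygon e x0 c N N)^~ t)).
Proof.
move=> r0 sE Eag WP cc cN.
have [pc p0 p1 pr] := polygon_curve r0 sE Eag cc cN (leqnn N).
have i0 : (0 <= 0 :> R) && (0 <= 1 :> R) by rewrite lexx ler01.
have i1 : (0 <= 1 :> R) && (1 <= 1 :> R) by rewrite lexx ler01.
have co t l : 0 <= t <= 1 -> coord (cube_of ((polygon e x0 c N N)^~ t)) l =
    polygon e x0 c N N l t.
  by move=> t01; rewrite coord_cube_of//; have [] := pr t t01.
split.
- apply: continuous_subspaceT; apply: cube_continuous => l t.
  apply: (@continuous_comp _ _ _ (polygon e x0 c N N l) clamp); first exact: pc.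
  exact: clamp_continuous.
- by apply: coord_inj => l; rewrite co.
- by apply: coord_inj => l; rewrite co.
- move=> t; rewrite /= in_itv => t01; have [_ [x hx]] := pr t t01.
  by apply: (WP _ x) => l lL; rewrite co//; exact: hx.
Qed.

Definition steps n : rel nat := [rel i j | (j == i.+1) && (i < n)%N].

Lemma path_steps n m k : (m + k = n)%N ->
  path (steps n) m (iota m.+1 k) /\ last m (iota m.+1 k) = n.
Proof.
elim: k m => [|k IH] m; first by rewrite addn0.
rewrite addnS => mk; have [|p lp] := IH m.+1; first by rewrite addSn.
by split=> //; apply/andP; split; rewrite // /steps /= eqxx -mk ltnS leq_addr.
Qed.

Lemma chain_seq E (a : nat -> X) n : (forall j, (j < n)%N -> E (a j, a j.+1)) ->
  is_chain E (a 0%N) (a n) (map a (iota 0 n.+1)).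
Proof.
move=> aE; have [p l] := path_steps (add0n n).
by have := chain_map (f := a) p (E := E); rewrite l; apply => i j /andP[/eqP -> /aE].
Qed.

(** A loop close to [X] is deformed to the polygon of the F-chain obtained by
    sampling it, this polygon is slowed down to leave room for the longest chain
    of the E-homotopy to a D-chain, and then deformed along the homotopy. *)
Lemma refine_movable :
  (forall E, sym_entourage E ->
    exists F, [/\ sym_entourage F, F `<=` E & loops_refine E F]) ->
  pointed_1_movable_in e x0.
Proof.
move=> ML U nU; have ce := embedding_continuous emb.
have [L [r [r0 UP]]] := nbhs_tube cX emb nU.
have r40 : 0 < r / 4 by rewrite divr_gt0.
have [d d0 dP] := dist_lt_agree cX emb L r40.
pose E : set (X * X) := dist_lt d.
have sE : sym_entourage E := sym_dist_lt d0.
have Eag x y : E (x, y) -> agree L (r / 4) (coord (e x)) (coord (e y)) by exact: dP.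
have [F [sF FE MLF]] := ML E sE.
have [L1 [r1 [r10 FP]]] := agree_entourage cX emb sF.
pose L' := maxn L L1; pose r' := Num.min (r / 4) (r1 / 3).
have r'0 : 0 < r' by rewrite lt_min r40 divr_gt0.
have r'r : r' <= r / 4 by rewrite ge_min lexx.
have r'r1 : r' <= r1 / 3 by rewrite ge_min lexx orbT.
exists (U `&` tube e L' r'); split.
- by move=> q rq; apply: filterI; [exact: nU|exact: tube_nbhs].
- by move=> q [].
move=> W nW WU g [cg g0 g1 gV].
have [L2 [r2 [r20 WP]]] := nbhs_tube cX emb nW.
have [d2 d20 d2P] := dist_lt_agree cX emb L2 r20.
pose D := E `&` dist_lt d2.
have sD : sym_entourage D := sym_entourageI sE (sym_dist_lt d20).
have DE : D `<=` E by move=> p [].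
have Dag x y : D (x, y) -> agree L2 r2 (coord (e x)) (coord (e y)) by move=> [_ /d2P].
have [dl dl0 gu] := loop_uniform L' cg r'0.
have [n [_ n0 nd]] := inv_nat_lt 0 dl0.
have nR0 : (0 : R) < n%:R by rewrite ltr0n.
pose T (j : nat) : R := j%:R / n%:R.
have T01 j : (j <= n)%N -> 0 <= T j <= 1 by exact: frac01.
have /choice[a aP] j : exists x, (j <= n)%N ->
    agree L' r' (coord (g (T j))) (coord (e x)) /\ ((j == 0) || (j == n) -> x = x0)%N.
  have [jn|] := leqP j n; last by exists x0.
  have [/orP j0n|] := boolP ((j == 0) || (j == n))%N.
    exists x0 => _; split=> // l lL.
    suff -> : g (T j) = e x0 by rewrite subrr normr0.
    case: j0n => /eqP -> {jn}; first by rewrite /T mul0r.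
    by rewrite /T divff ?gt_eqF.
  have [_ [x hx]] : (U `&` tube e L' r') (g (T j)).
    by apply: gV; rewrite /= in_itv; exact: T01.
  by exists x => _; split.
have an0 : a 0%N = x0 by have [_ ->] := aP 0%N (leq0n n).
have ann : a n = x0 by have [_ ->] := aP n (leqnn n); rewrite ?eqxx ?orbT.
have aF j : (j < n)%N -> F (a j, a j.+1).
  move=> jn; have [h1 _] := aP j (ltnW jn); have [h2 _] := aP j.+1 jn.
  have h3 := gu _ _ (T01 j (ltnW jn)) (T01 j.+1 jn).
  rewrite frac_step// in h3; have {}h3 := h3 nd.
  apply: FP; have := agree_trans (agreeC h1) (agree_trans h3 h2).
  by apply: agree_sub; [exact: leq_maxr|lra].
pose c := map a (iota 0 n.+1).
have sc : size c = n.+1 by rewrite size_map size_iota.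
have cc : is_chain F x0 x0 c by have := chain_seq aF; rewrite an0 ann.
have ccE := chain_sub FE cc.
have [c' cD hcc'] := MLF c D cc sD DE.
have r44 : r / 4 <= r by lra.
have EagL x y : E (x, y) -> agree L r (coord (e x)) (coord (e y)).
  by move=> /Eag; apply: agree_sub.
have [N0 hN0] := hom_deform r0 sE EagL hcc' ccE.
pose N := maxn N0 (maxn n (size c')).
have nN : (n <= N)%N by rewrite /N !leq_max leqnn !orbT.
have c'N : (size c' <= N.+1)%N by rewrite leqW// /N !leq_max leqnn !orbT.
exists (fun t => cube_of ((polygon e x0 c' N N)^~ t)).
  exact: (polygon_loop_in r20 sD Dag WP cD c'N).
pose gam l (t : R) := coord (g (clamp t)) l.
have curvec : curve e x0 L r (polygon e x0 c n n).
  by apply: (polygon_curve r0 sE EagL ccE) => //; rewrite sc.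
have i0 : (0 <= 0 :> R) && (0 <= 1 :> R) by rewrite lexx ler01.
have i1 : (0 <= 1 :> R) && (1 <= 1 :> R) by rewrite lexx ler01.
have gnear t : 0 <= t <= 1 -> exists x, agree L r (gam^~ t) (coord (e x)) /\
    agree L r ((polygon e x0 c n n)^~ t) (coord (e x)).
  move=> /[dup] t01 /andP[t0 t1].
  have nt0 : 0 <= n%:R * t by rewrite mulr_ge0// ltW.
  have [j nj] := node_ex n nt0; exists (nth x0 c j).
  have [_ cj _] := chain_nth sE ccE; have [jn [jt tj]] := nj.
  split; last first.
    move=> l lL; apply: (pl_near nj); first by rewrite subrr normr0.
    by move=> _; exact: (agreeC (EagL _ _ (cj j))).
  have -> : nth x0 c j = a j by rewrite /c (nth_map 0%N) ?size_iota// nth_iota.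
  have [h1 _] := aP j jn.
  have h2 : agree L' r' (coord (g t)) (coord (g (T j))) \/ t = T j.
    have [jln|] := ltnP j n; last first.
      move=> nj'; have jE : j = n by apply/eqP; rewrite eqn_leq jn.
      right; rewrite /T jE divff ?gt_eqF//; apply/eqP; rewrite eq_le t1 /=.
      by move: jt; rewrite jE -{1}(mulr1 n%:R) ler_pM2l.
    have {tj} := tj jln; rewrite -natr1 => tj.
    have [tjE|tjN] := eqVneq t ((j%:R + 1) / n%:R).
      (* the right end of the interval is the next sample point *)
      left; apply: gu => //; first exact: T01.
      by rewrite tjE natr1 distrC frac_step.
    left; apply: gu => //; first exact: T01.
    apply: lt_trans nd; have Tt : T j <= t by rewrite ler_pdivrMr// mulrC.
    rewrite ger0_norm ?subr_ge0// ltrBlDr -[n%:R^-1]mul1r -mulrDl addrC.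
    by rewrite lt_neqAle tjN /= ler_pdivlMr// mulrC.
  rewrite /gam; rewrite clamp_id//.
  case: h2 => [h2|->].
    by have := agree_trans h2 h1; apply: agree_sub; [exact: leq_maxl|lra].
  by apply: agree_sub h1; [exact: leq_maxl|lra].
have curveg : curve e x0 L r gam.
  split.
  - move=> l t; have cgc : continuous (g \o clamp).
      exact: within_comp cg (@clamp_continuous R) (@clamp_mem R).
    exact: (@continuous_comp _ _ _ (g \o clamp) (fun q => coord q l) t (cgc t)
      (@coord_continuous R l _)).
  - by move=> l; rewrite /gam clamp_id// g0.
  - by move=> l; rewrite /gam clamp_id// g1.
  - move=> t t01; split; first by move=> l; exact: coord_mem.
    by have [x [h _]] := gnear t t01; exists x.
have D1 : deform e x0 L r gam (polygon e x0 c n n) by exact: deform_straight.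
have D2 : deform e x0 L r (polygon e x0 c n n) (polygon e x0 c n N).
  by apply: (deform_speed r0 sE EagL ccE) => //; rewrite sc.
have D3 : deform e x0 L r (polygon e x0 c N N) (polygon e x0 c' N N).
  by apply: hN0; rewrite leq_maxl.
have pE : polygon e x0 c n N = polygon e x0 c N N.
  apply: functional_extensionality_dep => l; apply: functional_extensionality_dep => t.
  rewrite /polygon; apply/esym/pl_stable => // j nj.
  have [_ _ cend] := chain_nth sE ccE.
  by rewrite /vertices !cend ?sc// ltnS.
rewrite pE in D2.
apply: (deform_homotopic (gam := gam) (del := polygon e x0 c' N N) UP) => //.
- by move=> t l /andP[t0 t1]; rewrite /gam clamp_id.
- move=> t l t01; rewrite coord_cube_of//.
  have [_ _ _ pr] := polygon_curve r0 sE EagL (chain_sub DE cD) c'N (leqnn N).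
  by have [] := pr t t01.
- exact: (deform_trans D1 (deform_trans D2 D3)).
Qed.


(** * Pointed 1-movable continua are weakly chained *)

(** Two adjacent rows of a fine grid are the rails of a ladder. *)
Lemma grid_step E (a b : nat -> X) n : sym_entourage E ->
  a 0%N = b 0%N -> a n = b n ->
  (forall j, (j < n)%N -> [/\ E (a j, a j.+1), E (b j, b j.+1) & E (b j, a j.+1)]) ->
  (forall j, (j <= n)%N -> E (a j, b j)) ->
  chain_homotopic E (a 0%N) (a n) (map a (iota 0 n.+1)) (map b (iota 0 n.+1)).
Proof.
move=> sE ab0 abn hE hab; have [p l] := path_steps (add0n n).
have ca : is_chain E (a 0%N) (a n) (map a (iota 0 n.+1)).
  by apply: chain_seq => j /hE[].
have cb : is_chain E (a 0%N) (a n) (map b (iota 0 n.+1)).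
  by rewrite ab0 abn; apply: chain_seq => j /hE[].
have := @ladder X nat (steps n) E a b 0%N (iota 1 n) p _ (hab 0%N isT).
rewrite l -abn => lad.
have {}lad := lad (fun i j ij => ltac:(move: ij => /andP[/eqP -> ij];
  have [h1 h2 h3] := hE i ij; split => //; exact: hab)).
have h1 := @hom_ins X E (a 0%N) (a n) (map a (iota 0 n.+1)) (a n) [::].
rewrite cats0 in h1.
apply: hom_trans (h1 ca (chain_cat ca (chain1 _ _) (sym_refl _ sE))) _.
apply: hom_trans lad _; apply/hom_sym.
apply: (@hom_ins X E (a 0%N) (a n) [::] (a 0%N)) => //.
exact: chain_cons (sym_refl _ sE) cb.
Qed.

(** A sequence that repeats some of its terms is homotopic to the sequence
    without repetitions; the repetitions are removed from the end. *)
Lemma hom_slow E (f : nat -> X) (s : nat -> nat) n : sym_entourage E ->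
  s 0%N = 0%N ->
  (forall j, (j < n)%N -> s j.+1 = s j \/ s j.+1 = (s j).+1) ->
  (forall j, E (f j, f j.+1)) ->
  chain_homotopic E (f 0%N) (f (s n)) (map (f \o s) (iota 0 n.+1))
    (map f (iota 0 (s n).+1)).
Proof.
move=> sE s0 hs hf; elim: n hs => [|n IH] hs; first by rewrite /= s0; exact: hom_refl.
have {}IH := IH (fun j jn => hs j (leqW jn)).
have cf m : is_chain E (f 0%N) (f m) (map f (iota 0 m.+1)) by apply: chain_seq.
have cA := hom_chain (hom_sym IH) (cf _).
have iotaE m : iota 0 m.+2 = iota 0 m.+1 ++ [:: m.+1] by rewrite -(addn1 m.+1) iotaD.
rewrite iotaE map_cat [map _ [:: n.+1]]/=; have [->|sn] := hs n (ltnSn n).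
  apply: hom_trans IH; apply/hom_sym.
  have h1 := @hom_ins X E (f 0%N) (f (s n)) (map (f \o s) (iota 0 n.+1)) (f (s n)) [::].
  rewrite cats0 in h1; apply: (h1 cA).
  exact: chain_cat cA (chain1 _ _) (sym_refl _ sE).
rewrite sn iotaE map_cat.
exact: hom_catr (chain1 E (f (s n).+1)) (hf _) IH.
Qed.

Lemma frac_near (i i' n : nat) (d : R) : (0 < n)%N -> n%:R^-1 < d ->
  [\/ i' = i, i' = i.+1 | i = i'.+1] -> `|i%:R / n%:R - i'%:R / n%:R| < d.
Proof.
move=> n0 nd [->|->|->]; rewrite ?frac_step//.
  by rewrite subrr normr0; apply: lt_trans nd; rewrite invr_gt0 ltr0n.
by rewrite distrC frac_step.
Qed.

(** The polygon of an F-chain is deformed to a loop very close to [X]; the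
    homotopy is sampled on a fine grid and its values are rounded to [X]. The
    rounded rows are E-homotopic to one another, the first one is the given
    chain with repetitions and the last one is a D-chain. *)
Lemma movable_refine : pointed_1_movable_in e x0 -> forall E, sym_entourage E ->
  exists F, [/\ sym_entourage F, F `<=` E & loops_refine E F].
Proof.
move=> pm E sE; have [L [r3 [r30 EP]]] := agree_entourage cX emb sE.
pose r := r3 / 3; have r0 : 0 < r by rewrite divr_gt0.
have r3E : r + (r + r) <= r3 by rewrite /r; lra.
have [V [nV VU hV]] := pm _ (tube_nbhs (e := e) L r0).
have [L1 [r1 [r10 VP]]] := nbhs_tube cX emb nV.
have m0 : 0 < Num.min r r1 by rewrite lt_min r0.
have [d1 d10 d1P] := dist_lt_agree cX emb (maxn L L1) m0.
pose F : set (X * X) := E `&` dist_lt d1.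
have sF : sym_entourage F := sym_entourageI sE (sym_dist_lt d10).
have FE : F `<=` E by move=> p [].
exists F; split => // c D cc sD DE.
have FagL x y : F (x, y) -> agree L r (coord (e x)) (coord (e y)).
  by move=> [_ /d1P]; apply: agree_sub; rewrite ?leq_maxl// ge_min lexx.
have Fag1 x y : F (x, y) -> agree L1 r1 (coord (e x)) (coord (e y)).
  by move=> [_ /d1P]; apply: agree_sub; rewrite ?leq_maxr// ge_min lexx orbT.
have [L2 [r23 [r230 DP]]] := agree_entourage cX emb sD.
pose Lw := maxn L L2; pose rw := Num.min r (r23 / 3).
have rw0 : 0 < rw by rewrite lt_min r0 divr_gt0.
have rwr : rw <= r by rewrite ge_min lexx.
have rw23 : rw + (rw + rw) <= r23.
  by have : rw <= r23 / 3 by [rewrite ge_min lexx orbT]; lra.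
have [c0 cj cend] := chain_nth sF cc.
pose N := (size c).-1.
have cN : size c = N.+1 by rewrite prednK//; case: (c) cc => // -[].
pose g t := cube_of ((polygon e x0 c N N)^~ t).
have gV : loop_in V (e x0) g.
  by apply: (polygon_loop_in r10 sF Fag1 VP cc); rewrite cN.
have WU : tube e Lw rw `<=` tube e L r.
  by move=> q [x ag]; exists x; apply: agree_sub ag => //; exact: leq_maxl.
have [h [ch h0 h1 hW] [H [cH H01 Hends HU]]] := hV _ (tube_nbhs (e := e) Lw rw0) WU g gV.
have [d d0 Hu] := homotopy_uniform Lw cH rw0.
have [n [Nn n0 nd]] := inv_nat_lt N d0.
have nR0 : (0 : R) < n%:R by rewrite ltr0n.
pose T (j : nat) : R := j%:R / n%:R.
have T01 j : (j <= n)%N -> 0 <= T j <= 1 by exact: frac01.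
have Tmem j : (j <= n)%N -> `[0, 1]%classic (T j) by move=> /T01; rewrite /= in_itv.
have T0 : T 0%N = 0 by rewrite /T mul0r.
have Tn : T n = 1 by rewrite /T divff ?gt_eqF.
pose s j := (j * N %/ n)%N.
have s0 : s 0%N = 0%N by rewrite /s mul0n div0n.
have sn : s n = N by rewrite /s mulKn.
have /choice[a' aP'] (ij : nat * nat) : exists x, (ij.1 <= n)%N -> (ij.2 <= n)%N ->
    [/\ agree L r (coord (H (T ij.1, T ij.2))) (coord (e x)),
        (ij.2 = 0 \/ ij.2 = n -> x = x0)%N, (ij.1 = 0 -> x = nth x0 c (s ij.2))%N &
        (ij.1 = n -> agree Lw rw (coord (h (T ij.2))) (coord (e x)))%N].
  case: ij => i j /=; have [iN|] := leqP i n; last by exists x0.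
  have [jn|] := leqP j n; last by exists x0.
  have [j0n|nj0n] := pselect (j = 0 \/ j = n)%N.
    exists x0 => _ _; split => //.
    - have [H0 H1] := Hends _ (Tmem i iN).
      by case: j0n => ->; rewrite ?T0 ?Tn ?H0 ?H1 => l lL; rewrite subrr normr0.
    - by move=> _; case: j0n => ->; rewrite ?s0 ?sn ?c0// cend// cN.
    - by move=> _; case: j0n => ->; rewrite ?T0 ?Tn ?h0 ?h1 => l lL; rewrite subrr normr0.
  have [i0|ni0] := eqVneq i 0%N.
    exists (nth x0 c (s j)) => _ _; split => //; last by rewrite i0 => n0'; move: n0; rewrite -n0'.
    have [+ _] := H01 _ (Tmem j jn); rewrite i0 T0 => -> l lL.
    rewrite coord_cube_of; last by apply: pl_range => k; exact: coord_mem.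
    have NT : N%:R * T j = (j * N)%:R / n%:R by rewrite /T natrM mulrA (mulrC j%:R).
    have nj : node N (s j) (N%:R * T j : R).
      split; first by rewrite -sn; apply: leq_div2r; rewrite leq_mul2r jn orbT.
      rewrite NT; split.
        by rewrite ler_pdivlMr// -natrM ler_nat; exact: leq_divM.
      move=> _; rewrite ler_pdivrMr// -natrM ler_nat ltnW//.
      exact: ltn_ceil.
    apply: (pl_near nj); first by rewrite subrr normr0.
    by move=> _; exact: (agreeC (FagL _ _ (cj _))).
  have [in_|nin] := eqVneq i n.
    have [x hx] := hW _ (Tmem j jn); exists x => _ _; split => //.
      have [_ +] := H01 _ (Tmem j jn); rewrite in_ Tn => ->.
      by apply: agree_sub hx => //; exact: leq_maxl.
    by move=> i0; move: ni0; rewrite i0.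
  have [x hx] := HU _ _ (Tmem i iN) (Tmem j jn); exists x => _ _; split => //.
    by move=> i0; move: ni0; rewrite i0.
  by move=> i0; move: nin; rewrite i0 eqxx.
pose a i j := a' (i, j).
have aP i j : (i <= n)%N -> (j <= n)%N ->
    [/\ agree L r (coord (H (T i, T j))) (coord (e (a i j))),
        (j = 0 \/ j = n -> a i j = x0)%N, (i = 0 -> a i j = nth x0 c (s j))%N &
        (i = n -> agree Lw rw (coord (h (T j))) (coord (e (a i j))))%N].
  exact: (aP' (i, j)).
have aE i j i' j' : (i <= n)%N -> (j <= n)%N -> (i' <= n)%N -> (j' <= n)%N ->
    [\/ i' = i, i' = i.+1 | i = i'.+1] -> [\/ j' = j, j' = j.+1 | j = j'.+1] ->
    E (a i j, a i' j').
  move=> iN jn i'n j'n ii' jj'; apply: EP.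
  have [hA _ _ _] := aP i j iN jn; have [hB _ _ _] := aP i' j' i'n j'n.
  have hH := Hu _ _ _ _ (T01 i iN) (T01 j jn) (T01 i' i'n) (T01 j' j'n)
    (frac_near n0 nd ii') (frac_near n0 nd jj').
  have {}hH : agree L r (coord (H (T i, T j))) (coord (H (T i', T j'))).
    by apply: agree_sub hH => //; exact: leq_maxl.
  by have := agree_trans (agreeC hA) (agree_trans hH hB); exact: agree_sub.
pose row i := map (a i) (iota 0 n.+1).
have a0 i : (i <= n)%N -> a i 0%N = x0.
  by move=> iN; have [_ h' _ _] := aP i 0%N iN (leq0n n); apply: h'; left.
have an i : (i <= n)%N -> a i n = x0.
  by move=> iN; have [_ h' _ _] := aP i n iN (leqnn n); apply: h'; right.
have rows i : (i <= n)%N -> chain_homotopic E x0 x0 (row 0%N) (row i).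
  elim: i => [_|i IH iN]; first exact: hom_refl.
  apply: hom_trans (IH (ltnW iN)) _.
  have := @grid_step E (a i) (a i.+1) n sE.
  rewrite !a0 ?an ?(ltnW iN)//; apply=> // [j jn|j jn].
    by split; apply: aE; rewrite ?(ltnW iN) ?(ltnW jn)//;
      try (by constructor 1); try (by constructor 2); try (by constructor 3).
  by apply: aE; rewrite ?(ltnW iN)//; [constructor 2|constructor 1].
have row0 : chain_homotopic E x0 x0 (row 0%N) c.
  have -> : row 0%N = map (nth x0 c \o s) (iota 0 n.+1).
    apply/eq_in_map => j; rewrite mem_iota add0n ltnS /= => jn.
    by have [_ _ h' _] := aP 0%N j (leq0n n) jn; exact: h'.
  have cE : c = map (nth x0 c) (iota 0 (s n).+1).
    by rewrite sn -cN; exact: (esym (mkseq_nth x0 c)).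
  have := @hom_slow E (nth x0 c) s n sE s0.
  rewrite -cE c0 sn (cend N) ?cN//; apply=> [j jn|j]; last exact: FE (cj j).
  have sj : (s j <= s j.+1)%N by apply: leq_div2r; rewrite leq_mul2r leqnSn orbT.
  have : (s j.+1 <= (s j).+1)%N.
    have -> : (s j).+1 = ((n + j * N) %/ n)%N by rewrite divnDl// divnn n0.
    by rewrite /s mulSn leq_div2r// leq_add2r.
  by rewrite leq_eqVlt ltnS => /predU1P[->|sj']; [right|left; apply/eqP; rewrite eqn_leq sj' sj].
exists (row n); last first.
  exact: hom_trans (hom_sym row0) (rows n (leqnn n)).
have := @chain_seq D (a n) n; rewrite a0// an//; apply=> j jn; apply: DP.
have [_ _ _ hA] := aP n j (leqnn n) (ltnW jn); have [_ _ _ hB] := aP n j.+1 (leqnn n) jn.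
have hH := Hu _ _ _ _ (T01 n (leqnn n)) (T01 j (ltnW jn)) (T01 n (leqnn n)) (T01 j.+1 jn)
    (frac_near n0 nd (Or31 _ _ (erefl n))) (frac_near n0 nd (Or32 _ _ (erefl j.+1))).
have [_ e1] := H01 _ (Tmem j (ltnW jn)); have [_ e2] := H01 _ (Tmem j.+1 jn).
rewrite -/(T n) -/(T j) -/(T j.+1) Tn e1 e2 in hH.
have := agree_trans (agreeC (hA erefl)) (agree_trans hH (hB erefl)).
by apply: agree_sub => //; exact: leq_maxr.
Qed.

End Movable.

(** An F-edge completed to a loop by fine chains to and from the base point
    is itself refinable once the loop is. *)
Lemma loops_refine_edge (R : realType) (X : metricType R) (x0 : X)
    (E F : set (X * X)) : @chain_connected X -> sym_entourage E ->
  sym_entourage F -> F `<=` E -> loops_refine x0 E F -> refines F E.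
Proof.
move=> conX sE sF FE hF x y xy D sD DE.
have sDF := sym_entourageI sD sF.
have DF_D : D `&` F `<=` D by move=> p [].
have DF_F : D `&` F `<=` F by move=> p [].
have [u cu] := conX _ sDF x0 x; have [v cv] := conX _ sDF y x0.
have cuF := chain_sub DF_F cu; have cvF := chain_sub DF_F cv.
have ruv := hF _ D (chain_cat cuF cvF xy) sD DE.
have [ru rv] := (chain_sub DF_D cu, chain_sub DF_D cv).
have [[cuE cvE] Exy] := (chain_sub FE cuF, chain_sub FE cvF, FE _ xy).
have cyv := chain_cat (chain1 E y) cvE (sym_refl _ sE).
have cxyv := chain_cat (chain2 Exy) cvE (sym_refl _ sE).
apply: (ref_cancelr sE sD DE (ref_chain E rv) (chain2 Exy) (sym_refl _ sD)).
apply: (ref_cancell sE sD DE (ref_chain E ru) cxyv (sym_refl _ sD)).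
apply: (ref_hom _ ruv); apply: (@hom_trans _ _ _ _ _ (u ++ y :: v)).
  apply: hom_ins; first exact: chain_cat cuE cvE Exy.
  exact: chain_cat cuE cyv Exy.
apply: hom_ins; first exact: chain_cat cuE cyv Exy.
exact: chain_cat cuE cxyv (sym_refl _ sE).
Qed.

Lemma weakly_chained_movable (R : realType) (X : metricType R) :
  [set: X] !=set0 -> compact [set: X] -> weakly_chained X ->
  pointed_1_movable R X.
Proof.
move=> X0 cX /weakly_chainedP[_ wc].
have [e emb] := compact_metric_embedding cX X0; have [x0 _] := X0.
exists e, x0; split=> //; apply: refine_movable => // E sE.
have [F [sF FE hF]] := wc E sE; exists F; split=> // c D cc sD DE.
exact: (refines_chain sE sD FE DE hF cc).
Qed.

Lemma movable_weakly_chained (R : realType) (X : metricType R) :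
  compact [set: X] -> connected [set: X] -> pointed_1_movable R X ->
  weakly_chained X.
Proof.
move=> cX /connected_chain_connected conX [e [x0 [emb pm]]].
apply/weakly_chainedP; split=> // E sE.
have [F [sF FE hF]] := movable_refine cX emb pm sE.
by exists F; split=> //; exact: loops_refine_edge hF.
Qed.

Theorem mainTheorem3 (R : realType) (X : metricType R)
    (X_nonempty : [set: X] !=set0) (X_compact : compact [set: X])
    (X_connected : connected [set: X]) :
  [<-> weakly_chained X;
       locally_uniformly_joinable X;
       uniformly_joinable X;
       pointed_1_movable R X].
Proof.
tfae.
- exact: weakly_chained_locally_joinable.
- exact: locally_joinable_joinable.
- move=> /(joinable_weakly_chained X_nonempty X_compact X_connected).
  exact: weakly_chained_movable.
- exact: movable_weakly_chained.
Qed.
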